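(* On every infinite dimensional separable Banach space $X$ there exists a bounded linear operator $T:X\to X$ which is hypercyclic and distributionally chaotic, and which admits a dense distributionally irregular manifold.
   Context: $T$ is hypercyclic if there is $x\in X$ whose orbit $\{x,Tx,T^2x,\dots\}$ is dense in $X$. For $A\subset\mathbb{N}$, $\overline{\operatorname{dens}}(A)=\limsup_{n}\frac{\operatorname{card}(A\cap[1,n])}{n}$ and $\underline{\operatorname{dens}}(A)=\liminf_{n}\frac{\operatorname{card}(A\cap[1,n])}{n}$. $T$ is distributionally chaotic if there exist an uncountable subset $\Gamma\subset X$ and $\varepsilon>0$ such that for all distinct $x,y\in\Gamma$ and every $\tau>0$, $\underline{\operatorname{dens}}\{n\in\mathbb{N}:\|T^nx-T^ny\|<\varepsilon\}=0$ and $\overline{\operatorname{dens}}\{n\in\mathbb{N}:\|T^nx-T^ny\|<\tau\}=1$. A vector $x\in X$ is distributionally irregular for $T$ if there are increasing sequences of positive integers $A=(n_k)_k$ and $B=(m_k)_k$ such that $\overline{\operatorname{dens}}(A)=\overline{\operatorname{dens}}(B)=1$ (regarding $A,B$ as subsets of $\mathbb{N}$), $\lim_k\|T^{n_k}x\|=0$ and $\lim_k\|T^{m_k}x\|=\infty$. A distributionally irregular manifold for $T$ is a linear subspace $Y\subset X$ (not necessarily closed) such that every $y\in Y\setminus\{0\}$ is distributionally irregular for $T$; it is dense if $Y$ is dense in $X$. *)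

(* Defs.v *)
From HB Require Import structures.
From mathcomp Require Import all_boot all_order all_algebra.
From mathcomp Require Import all_classical all_reals all_analysis.
From mathcomp Require Export complex.
Set Implicit Arguments.
Unset Strict Implicit.
Unset Printing Implicit Defensive.
Import Order.TTheory GRing.Theory Num.Theory.
Import numFieldNormedType.Exports.
Local Open Scope classical_set_scope.
Local Open Scope ring_scope.

(* The value at n = 0 is 0 (division by zero) and does not affect the limits. *)
Definition frequency (R : realType) (A : set nat) (n : nat) : R :=
  (\sum_(1 <= k < n.+1 | k \in A) 1)%N%:R / n%:R.

Definition upper_density (R : realType) (A : set nat) : \bar R :=
  limn_esup (fun n => (frequency R A n)%:E).

Definition lower_density (R : realType) (A : set nat) : \bar R :=
  limn_einf (fun n => (frequency R A n)%:E).

Definition finite_dimensional (K : numFieldType) (X : lmodType K) : Prop :=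
  exists (n : nat) (e : 'I_n -> X),
    forall x : X, exists a : 'I_n -> K, x = \sum_(i < n) a i *: e i.

Definition separable (X : topologicalType) : Prop :=
  exists D : set X, countable D /\ dense D.

Definition hypercyclic (X : topologicalType) (T : X -> X) : Prop :=
  exists x : X, dense (range (fun n : nat => iter n T x)).

(* The scalar field K is meant to be R or R[i]. Norms take their values in K,
   where 0 < eps forces eps to be a positive real; densities live in R. *)
Definition distributionally_chaotic (R : realType) (K : numFieldType)
    (X : normedModType K) (T : X -> X) : Prop :=
  exists (Gamma : set X) (eps : K),
    [/\ ~ countable Gamma, 0 < eps
      & forall x y : X, Gamma x -> Gamma y -> x <> y ->
        forall tau : K, 0 < tau ->
          lower_density R
            [set n : nat | `|iter n T x - iter n T y| < eps] = 0%E /\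
          upper_density R
            [set n : nat | `|iter n T x - iter n T y| < tau] = 1%E].

Definition increasing_positive (n_ : nat -> nat) : Prop :=
  (forall k : nat, (0 < n_ k)%N) /\ {homo n_ : k l / (k < l)%N}.

Definition distributionally_irregular (R : realType) (K : numFieldType)
    (X : normedModType K) (T : X -> X) (x : X) : Prop :=
  exists n_ m_ : nat -> nat,
    [/\ increasing_positive n_ /\ increasing_positive m_,
        upper_density R (range n_) = 1%E,
        upper_density R (range m_) = 1%E,
        `|iter (n_ k) T x| @[k --> \oo] --> (0 : K)
      & `|iter (m_ k) T x| @[k --> \oo] --> +oo_K].

Definition linear_subspace (K : numFieldType) (X : lmodType K)
    (Y : set X) : Prop :=
  Y 0 /\ forall (a : K) (u v : X), Y u -> Y v -> Y (a *: u + v).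

Definition distributionally_irregular_manifold (R : realType)
    (K : numFieldType) (X : normedModType K) (T : X -> X) (Y : set X) : Prop :=
  linear_subspace Y /\
  forall y : X, Y y -> y <> 0 -> distributionally_irregular R T y.

(* Main.v *)
(** The operator is T = I + S, where S is a nuclear weighted backward shift along
    a biorthogonal sequence with dense span.  In the rescaled basis y_m, with
    S y_0 = 0 and S y_{m+1} = y_m, a finite combination of the y_m is encoded by
    the polynomial g whose successive differences at 0 are its coordinates, and
    T acts on g as the translation by 1.  The polynomials
    binomial(x, k) (1 - x/M)^L and binomial(x, k) (1 + x/M)^L, with M polynomial
    in the degree, give vectors close to y_k whose orbit is small on all of
    [M/j, M], respectively whose M-th backward iterate is small.  This works as
    soon as the norms of the y_m grow slowly along infinitely many blocks, which
    is arranged by inserting long Auerbach-like blocks (near-maximal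
    determinants) into the biorthogonal sequence.  Baire's argument then yields
    one hypercyclic vector z whose orbit tends to 0 along a set of upper density
    one and such that p(S) z has an orbit tending to infinity along a set of
    upper density one for every polynomial p <> 0.  The span of the S^i z is the
    required manifold, and the real multiples of z are the required
    uncountable set. *)
From HB Require Import structures.
Require Import Defs.
From mathcomp Require Import all_boot all_order all_algebra.
From mathcomp Require Import all_classical all_reals all_analysis.
From mathcomp Require Import perm.
From mathcomp Require Import ring lra zify.
Set Implicit Arguments.
Unset Strict Implicit.
Unset Printing Implicit Defensive.
Import Order.TTheory GRing.Theory Num.Theory.
Import numFieldNormedType.Exports.
Local Open Scope classical_set_scope.
Local Open Scope ring_scope.

(** * Finite differences *)

Section FiniteDifferences.
Variable R : realType.
Implicit Types (f g : R -> R) (c x A B r s : R) (m i k b N L : nat).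

(** The obstacle is that the functionals of a biorthogonal sequence with dense span may have norms
    growing arbitrarily fast, and the norms of the $y_m$ are inverse products of weights that must
    compensate for them. What can be secured, for infinitely many $N$ only, is $\|y_{k+j}\| \le b_k
    (N+1)^{3j}$ for $k+j \le N$. Each index thus costs $(N+1)^3$, and a vector given by a polynomial
    of degree $N$ is controlled as soon as each difference gains more than that. Stretching the
    polynomial to the scale $M = (N+1)^8$ does this, since a difference of $(1 \pm x/M)^L$ with $L
    \le N$ gains about $N/M$. The power is also close to 1 near 0 and exponentially small in $N$
    where $|1 \pm x/M| \le \rho < 1$; this beats the factor $M^k$ coming from the binomial
    coefficient. Escape to infinity is detected by a single functional: if $f_0(y_m)$ is 1 for $m =
    0$ and 0 otherwise, then $f_0(T^n y_k)$ is the binomial coefficient of $n$ and $k$, so a higher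
    index eventually dominates all lower ones. *)

Definition diff f : R -> R := fun x => f (x + 1) - f x.

Lemma diffS m f x : iter m.+1 diff f x = iter m diff f (x + 1) - iter m diff f x.
Proof. by []. Qed.

Lemma diffSr m f : iter m.+1 diff f = iter m diff (diff f).
Proof. exact: iterSr. Qed.

Lemma diffD m f g x :
  iter m diff (fun y => f y + g y) x = iter m diff f x + iter m diff g x.
Proof. by elim: m x => [//|m IH] x; rewrite !diffS !IH; ring. Qed.

Lemma diff_shift m f x : iter m diff (fun y => f (y + 1)) x = iter m diff f (x + 1).
Proof. by elim: m x => [//|m IH] x; rewrite !diffS !IH. Qed.

Lemma diff_cst m (a : R) x : iter m.+1 diff (fun=> a) x = 0.
Proof.
by elim: m x => [|m IH] x; rewrite diffS ?IH ?subrr.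
Qed.

Lemma diffM f g :
  diff (fun x => f x * g x) = (fun x => diff f x * g (x + 1) + f x * diff g x).
Proof. by apply/funext => x; rewrite /diff; ring. Qed.

(** The $m$-th difference at $c+i$ involves the values at $c+i, \dots, c+i+m$, so [m + i <= b]
    confines everything to the window of the points $c, \dots, c+b$. *)
Definition diff_bounded f A r c b :=
  forall m i, (m + i <= b)%N -> `|iter m diff f (c + i%:R)| <= A * r ^+ m.

(** Leibniz rule $\Delta(fg)(x) = \Delta f(x)\, g(x+1) + f(x)\, \Delta g(x)$: differencing one
    factor multiplies its constant by $r$ or $s$, and $m$ such choices sum to $(r+s)^m$. Each
    difference or shift uses up one point of the window. *)
Lemma diff_boundedM f g A B r s c b : 0 <= A -> 0 <= B -> 0 <= r -> 0 <= s ->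
  diff_bounded f A r c b -> diff_bounded g B s c b ->
  diff_bounded (fun x => f x * g x) (A * B) (r + s) c b.
Proof.
move=> + + r0 s0 + + m.
elim: m f g A B b => [|m IH] f g A B b A0 B0 fA gB i mib.
  have := fA 0%N i mib; have := gB 0%N i mib; rewrite /= !expr0 !mulr1 normrM.
  by move=> ? ?; apply: ler_pM.
case: b => [//|b] in mib fA gB *.
rewrite diffSr diffM diffD (le_trans (ler_normD _ _))//.
have -> : A * B * (r + s) ^+ m.+1 =
  (A * r) * B * (r + s) ^+ m + A * (B * s) * (r + s) ^+ m by rewrite exprS; ring.
rewrite lerD//.
- apply: (IH (diff f) (fun x => g (x + 1)) _ _ b) => //.
  + exact: mulr_ge0.
  + move=> m' i' h; rewrite -diffSr (le_trans (fA m'.+1 i' _)) ?exprS ?mulrA//.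
  + by move=> m' i' h; rewrite diff_shift -addrA natr1 gB// addnS.
- apply: (IH f (diff g) _ _ b) => //.
  + exact: mulr_ge0.
  + by move=> m' i' h; rewrite fA// ltnW.
  + move=> m' i' h; rewrite -diffSr (le_trans (gB m'.+1 i' _)) ?exprS ?mulrA//.
Qed.

Lemma diff_boundedX f A r c b L : 0 <= A -> 0 <= r ->
  diff_bounded f A r c b ->
  diff_bounded (fun x => f x ^+ L) (A ^+ L) (L%:R * r) c b.
Proof.
move=> A0 r0 fA; elim: L => [|L IH].
  move=> [|m] i _; first by rewrite /= !expr0 mulr1 normr1.
  have -> : (fun x => f x ^+ 0) = (fun=> 1) by apply/funext => x; rewrite expr0.
  by rewrite diff_cst normr0 mul0r expr0n/= mulr0.
have -> : (fun x => f x ^+ L.+1) = (fun x => f x * f x ^+ L).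
  by apply/funext => x; rewrite exprS.
have -> : L.+1%:R * r = r + L%:R * r by rewrite -nat1r; ring.
by rewrite exprS; apply: diff_boundedM => //; rewrite ?exprn_ge0 ?mulr_ge0.
Qed.

Lemma diff_bounded_affine (s A c : R) b : 0 < A ->
  (forall i, (i <= b)%N -> `|1 + s * (c + i%:R)| <= A) ->
  diff_bounded (fun x => 1 + s * x) A (`|s| / A) c b.
Proof.
move=> A0 sA [|m] i ib; first by rewrite expr0 mulr1 sA.
rewrite diffSr.
have -> : diff (fun x => 1 + s * x) = (fun=> s).
  by apply/funext => x; rewrite /diff; ring.
case: m ib => [|m] ib; first by rewrite /= expr1 mulrCA divff ?mulr1// gt_eqF.
by rewrite diff_cst normr0 mulr_ge0 ?exprn_ge0 ?divr_ge0// ltW.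
Qed.

Definition diff_degree f (a : nat) := forall x, iter a.+1 diff f x = 0.

Lemma diff_degreeM f g (a b : nat) : diff_degree f a -> diff_degree g b ->
  diff_degree (fun x => f x * g x) (a + b).
Proof.
have [n] := ubnP (a + b); elim: n f g a b => [//|n IH] f g a b abn fa gb x.
rewrite diffSr diffM diffD.
have shift : diff_degree (fun y => g (y + 1)) b by move=> y; rewrite diff_shift gb.
have zero (h : R -> R) : h =1 (fun=> 0) -> forall k y, iter k diff h y = 0.
  by move=> /funext -> [//|k] y; rewrite diff_cst.
have -> : iter (a + b) diff (fun x => diff f x * g (x + 1)) x = 0.
  case: a fa abn => [|a] fa abn.
    by apply: zero => y; rewrite (fa y : diff f y = 0) mul0r.
  by apply: (IH (diff f) (fun x => g (x + 1)) a b) => // y; rewrite -diffSr.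
rewrite add0r.
case: b gb {shift} abn => [|b] gb abn.
  by apply: zero => y; rewrite (gb y : diff g y = 0) mulr0.
by rewrite addnS; apply: (IH f (diff g) a b);
  [rewrite -ltnS -addnS | | move=> y; rewrite -diffSr].
Qed.

Lemma diff_degreeX f L : diff_degree f 1 -> diff_degree (fun x => f x ^+ L) L.
Proof.
move=> f1; elim: L => [|L IH] x.
  have -> : (fun x => f x ^+ 0) = (fun=> 1) by apply/funext => y; rewrite expr0.
  exact: diff_cst.
have -> : (fun x => f x ^+ L.+1) = (fun x => f x * f x ^+ L).
  by apply/funext => y; rewrite exprS.
exact: (diff_degreeM f1 IH).
Qed.

Lemma diff_degree_affine (s : R) : diff_degree (fun x => 1 + s * x) 1.
Proof. by move=> x; rewrite /= /diff; ring. Qed.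

(** The binomial coefficient $x(x-1)\cdots(x-k+1)/k!$ at a real argument. *)
Fixpoint gbinom k x : R :=
  if k is k'.+1 then gbinom k' x * (x - k'%:R) / k'.+1%:R else 1.

Lemma gbinomS k x : gbinom k.+1 (x + 1) = gbinom k x * (x + 1) / k.+1%:R.
Proof.
elim: k => [|k IH]; first by rewrite /= subr0 !mul1r.
have k1 : k.+1%:R != 0 :> R by rewrite pnatr_eq0.
have k2 : k.+2%:R != 0 :> R by rewrite pnatr_eq0.
rewrite [LHS]/= -/(gbinom k.+1 (x + 1)) IH /= -natr1; field.
by rewrite [_ + 1]natr1 k1 andbT -natrD.
Qed.

Lemma diff_gbinom k : diff (gbinom k.+1) = gbinom k.
Proof.
apply/funext => x; rewrite /diff gbinomS /=.
have k1 : k.+1%:R != 0 :> R by rewrite pnatr_eq0.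
by move: k1; rewrite -natr1 => k1; field.
Qed.

Lemma iter_diff_gbinom m k : (m <= k)%N -> iter m diff (gbinom k) = gbinom (k - m).
Proof.
elim: m => [|m IH] mk; first by rewrite subn0.
by rewrite iterS IH ?(ltnW mk)// -(subnSK mk) diff_gbinom.
Qed.

Lemma diff_degree_gbinom k : diff_degree (gbinom k) k.
Proof.
by move=> x; rewrite iterS iter_diff_gbinom// subnn /diff /= subrr.
Qed.

Lemma gbinom0 k : gbinom k 0 = (k == 0%N)%:R.
Proof.
elim: k => [//|[|k] IH]; first by rewrite /= subr0 mulr0 mul0r.
by rewrite [gbinom _ _]/= -/(gbinom k.+1 0) IH !mul0r.
Qed.

Lemma gbinom_le k x B : `|x| + k%:R <= B -> `|gbinom k x| <= B ^+ k.
Proof.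
elim: k => [|k IH] xB; first by rewrite expr0 normr1.
rewrite /= 2!normrM exprSr.
have B0 : 0 <= B by rewrite (le_trans _ xB)// addr_ge0.
rewrite -mulrA ler_pM//.
  by apply: IH; rewrite (le_trans _ xB)// lerD2l ler_nat.
rewrite normfV (ger0_norm (ler0n _ k.+1)) ler_pdivrMr ?ltr0n//.
have k0 : 0 <= k%:R :> R by [].
have k1 : 1 <= k.+1%:R :> R by rewrite ler1n.
rewrite (le_trans (ler_normB _ _))// (ger0_norm k0).
rewrite (le_trans _ (ler_peMr B0 k1))// (le_trans _ xB)// lerD2l ler_nat//.
Qed.

(** Each difference lowers $k$ by one, and with it the bound $B^k$ by a factor $B$. *)
Lemma diff_bounded_gbinom k B c b : 0 < B ->
  (forall i, (i <= b)%N -> `|c + i%:R| + k%:R <= B) ->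
  diff_bounded (gbinom k) (B ^+ k) B^-1 c b.
Proof.
move=> B0 cB m i mib.
have [mk|km] := leqP m k.
  rewrite iter_diff_gbinom// exprVn -expfB_cond; last first.
    by rewrite gt_eqF.
  apply: gbinom_le; apply: (le_trans _ (cB i _)).
    by rewrite lerD2l ler_nat leq_subr.
  by rewrite (leq_trans _ mib)// leq_addl.
rewrite -(subnK km) iterD (_ : iter k.+1 _ _ = (fun=> 0)); last first.
  by apply/funext => x; exact: diff_degree_gbinom.
case: (m - k.+1)%N => [|n]; rewrite ?diff_cst /= normr0;
  by rewrite mulr_ge0 ?exprn_ge0 ?invr_ge0 ?ltW.
Qed.

(** By the iterated Leibniz rule, the $m$-th difference at 0 of the product is $\binom{m}{k}
    \Delta^{m-k} h(k)$, because $\Delta^i \binom{x}{k}$ at 0 is 1 for $i = k$ and 0 otherwise; then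
    $\binom{m}{k} \le 2^m$. The induction follows Pascal's recursion. *)
Lemma diff_gbinomM_0 k h B s b : 0 <= B -> 0 <= s -> diff_bounded h B s 0 b ->
  forall m, (m <= b)%N ->
  `|iter m diff (fun x => gbinom k x * h x) 0| <=
    if (m < k)%N then 0 else 2 ^+ m * B * s ^+ (m - k).
Proof.
move=> B0 s0 hB m mb.
elim: m k h B b B0 hB mb => [|m IH] k h B b B0 hB mb.
  rewrite /= gbinom0; case: k => [|k]; last by rewrite mul0r normr0.
  by have := hB 0%N 0%N mb; rewrite /= addr0 !mul1r.
case: b => [//|b] in mb hB *.
have Dh : diff_bounded (diff h) (B * s) s 0 b.
  by move=> m' i' h'; rewrite -diffSr -mulrA -exprS hB.
rewrite diffSr diffM diffD (le_trans (ler_normD _ _))//.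
have Sh : diff_bounded (fun x => h (x + 1)) B s 0 b.
  by move=> m' i' h'; rewrite diff_shift -addrA natr1 hB// addnS.
case: k => [|k].
  have -> : (fun x => diff (gbinom 0) x * h (x + 1)) = (fun=> 0).
    by apply/funext => x; rewrite /diff /= subrr mul0r.
  have -> : iter m diff (fun=> 0 : R) 0 = 0 by case: m {IH mb} => [//|m]; rewrite diff_cst.
  rewrite normr0 add0r (le_trans (IH 0%N (diff h) (B * s) b _ Dh mb)) ?mulr_ge0//.
  rewrite !subn0 exprS (exprS s).
  have : 0 <= 2 ^+ m * B * (s * s ^+ m) by rewrite !mulr_ge0 ?exprn_ge0.
  by lra.
rewrite diff_gbinom.
have := IH k (fun x => h (x + 1)) B b B0 Sh mb.
have := IH k.+1 (diff h) (B * s) b (mulr_ge0 B0 s0) Dh mb.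
rewrite ltnS subSS; case: (ltngtP m k) => [mk|km|->].
- by rewrite ltnS mk => h1 h2; rewrite (le_trans (lerD h2 h1))// addr0.
- rewrite ltnS (leq_gtF (ltnW km)) => h1 h2.
  rewrite (le_trans (lerD h2 h1))//.
  have -> : (m - k = (m - k.+1).+1)%N by rewrite subnSK.
  by rewrite !exprS; lra.
- rewrite ltnn subnn expr0 => h1 h2.
  rewrite -[leRHS]addr0 lerD// (le_trans h2)// exprS.
  have : 0 <= 2 ^+ k * B by rewrite mulr_ge0 ?exprn_ge0.
  by lra.
Qed.

Lemma norm_expr1D_sub1 (e : R) L : 2 * L%:R * `|e| <= 1 ->
  `|(1 + e) ^+ L - 1| <= 2 * L%:R * `|e|.
Proof.
elim: L => [|L IH] Le; first by rewrite expr0 subrr normr0 mulr0 mul0r.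
have e0 : 0 <= `|e| by [].
have L0 : 0 <= L%:R :> R by [].
have eqL : L.+1%:R = L%:R + 1 :> R by rewrite natr1.
rewrite eqL in Le *.
have Le' : 2 * L%:R * `|e| <= 1 by nra.
have {}IH := IH Le'.
have -> : (1 + e) ^+ L.+1 - 1 = (1 + e) * ((1 + e) ^+ L - 1) + e.
  by rewrite exprS; ring.
rewrite (le_trans (ler_normD _ _))// normrM.
have : `|1 + e| <= 1 + `|e| by rewrite (le_trans (ler_normD _ _))// normr1.
move=> ve; have := ler_pM (normr_ge0 _) (normr_ge0 _) ve IH.
move: (_ * `|_|) => w; nra.
Qed.

(** With $t = s^2$, one power of $n+1$ is absorbed by one copy of $s^n$, since $(n+1)s^n \le 1 + s +
    \cdots + s^n \le 1/(1-s)$; the other copy goes to the induction hypothesis. *)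
Lemma poly_geometric_bounded (e : nat) (t : R) : 0 <= t < 1 ->
  exists C : R, forall n, n.+1%:R ^+ e * t ^+ n <= C.
Proof.
elim: e t => [|e IH] t /andP[t0 t1].
  by exists 1 => n; rewrite expr0 mul1r exprn_ile1// ltW.
pose s := Num.sqrt t.
have s0 : 0 <= s by exact: sqrtr_ge0.
have s2 : s ^+ 2 = t by rewrite sqr_sqrtr.
have s1 : s < 1 by rewrite -sqrtr1 ltr_sqrt.
have [C HC] : exists C : R, forall n, n.+1%:R ^+ e * s ^+ n <= C.
  by apply: IH; rewrite s0 s1.
exists (C / (1 - s)) => n.
have -> : n.+1%:R ^+ e.+1 * t ^+ n =
    (n.+1%:R ^+ e * s ^+ n) * (n.+1%:R * s ^+ n).
  by rewrite -s2 -exprM mulnC exprM exprS; ring.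
apply: ler_pM; rewrite ?HC ?mulr_ge0 ?exprn_ge0//.
rewrite -[leRHS]mul1r ler_pdivlMr ?subr_gt0//.
have h : n.+1%:R * s ^+ n <= \sum_(i < n.+1) s ^+ i.
  rewrite mulr_natl -[X in _ *+ X]card_ord -sumr_const ler_sum// => i _.
  by rewrite ler_wiXn2l// ?ltW// -ltnS.
have g : (\sum_(i < n.+1) s ^+ i) * (1 - s) = 1 - s ^+ n.+1.
  rewrite -[in RHS](expr1n _ n.+1) subrXX mulrC; congr (_ * _).
  by apply: eq_bigr => i _; rewrite expr1n mul1r.
rewrite (le_trans (ler_wpM2r _ h)) ?subr_ge0 ?(ltW s1)// g.
by rewrite gerBl exprn_ge0.

Qed.
End FiniteDifferences.

(** * Densities *)

Section Densities.
Variable R : realType.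

Lemma invS_lt (e : R) : 0 < e -> exists j : nat, j.+1%:R^-1 < e.
Proof.
move=> e0; exists (Num.truncn e^-1).
by rewrite -ltf_pV2 ?posrE ?invr_gt0 ?ltr0n// invrK truncnS_gt.
Qed.

Lemma frequency_ge0 (A : set nat) n : 0 <= frequency R A n.
Proof. by rewrite /frequency divr_ge0. Qed.

Lemma frequency_le1 (A : set nat) n : frequency R A n <= 1.
Proof.
rewrite /frequency; case: n => [|n]; first by rewrite invr0 mulr0.
rewrite ler_pdivrMr ?ltr0n// mul1r ler_nat.
rewrite big_mkcond/=; apply: (@leq_trans (\sum_(1 <= k < n.+2) 1)).
  by apply: leq_sum => k _; case: ifP.
by rewrite sum_nat_const_nat subSS subn0 muln1.
Qed.

Lemma frequency_ge (A : set nat) (j M : nat) : (0 < M)%N ->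
  (forall n, (M <= j.+1 * n)%N -> (n <= M)%N -> A n) ->
  1 - j.+1%:R^-1 <= frequency R A M.
Proof.
move=> M0 MA; rewrite /frequency.
pose q := (M %/ j.+1)%N.
have qM : (q <= M)%N by exact: leq_div.
have : (M - q <= \sum_(1 <= k < M.+1 | k \in A) 1)%N.
  rewrite (big_cat_nat (n := q.+1))//=; apply: leq_trans (leq_addl _ _).
  rewrite big_nat_cond (eq_bigl (fun k => (q.+1 <= k < M.+1)%N && true)).
    by rewrite -big_nat_cond sum_nat_const_nat subSS muln1.
  move=> k; rewrite andbT; case: (boolP (q < k < M.+1)%N) => //= /andP[qk kM].
  apply: mem_set; apply: MA => //.
  rewrite mulnC ltnW// -ltn_divLR//.
rewrite -(ler_nat R) natrB//.
set S := (\sum_(_ <= k < _ | _) _)%N => MqS.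
rewrite ler_pdivlMr ?ltr0n// (le_trans _ MqS)// mulrBl mul1r lerB//.
rewrite ler_pdivlMl ?ltr0n// -natrM ler_nat mulnC /q leq_trunc_div//.
Qed.

Lemma frequency_le (A : set nat) (j M : nat) : (0 < M)%N ->
  (forall n, (M <= j.+1 * n)%N -> (n <= M)%N -> ~ A n) ->
  frequency R A M <= j.+1%:R^-1.
Proof.
move=> M0 MA; rewrite /frequency.
pose q := (M %/ j.+1)%N.
have qM : (q <= M)%N by exact: leq_div.
have : (\sum_(1 <= k < M.+1 | k \in A) 1 <= q)%N.
  rewrite (big_cat_nat (n := q.+1))//=.
  rewrite [X in (_ + X <= _)%N]big_nat_cond [X in (_ + X <= _)%N]big_pred0.
    rewrite addn0 big_mkcond/=; apply: (@leq_trans (\sum_(1 <= k < q.+1) 1)).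
      by apply: leq_sum => k _; case: ifP.
    by rewrite sum_nat_const_nat subSS subn0 muln1.
  move=> k; apply/negP => /andP[/andP[qk kM]] /set_mem; apply: MA => //.
  rewrite mulnC ltnW// -ltn_divLR//.
rewrite -(ler_nat R).
set S := (\sum_(_ <= k < _ | _) _)%N => Sq.
rewrite ler_pdivrMr ?ltr0n// (le_trans Sq)//.
rewrite ler_pdivlMl ?ltr0n// -natrM ler_nat mulnC /q leq_trunc_div//.
Qed.

(** A window $[M/(j+1), M]$ misses at most a fraction $1/(j+1)$ of $[1, M]$. All density statements
    below are reduced to such windows, written without division. *)
Lemma upper_density_eq1 (A : set nat) :
  (forall j : nat, exists2 M, (j < M)%N &
    forall n, (M <= j.+1 * n)%N -> (n <= M)%N -> A n) ->
  upper_density R A = 1%E.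
Proof.
move=> HA; rewrite /upper_density limn_esup_lim.
suff -> : esups (fun n => (frequency R A n)%:E) = cst 1%E by rewrite lim_cst.
apply/funext => n /=; apply/eqP; rewrite eq_le; apply/andP; split.
  apply: ge_ereal_sup => _ [m _ <-].
  by rewrite lee_fin frequency_le1.
apply/lee_addgt0Pr => e e0.
have [j je] : exists j : nat, j.+1%:R^-1 < e.
  exact: invS_lt.
(* Using [maxn j n] pushes $M$ beyond $n$, so that it counts in the supremum of the tail starting at
   $n$. *)
have [M jM MA] := HA (maxn j n).
have MA' k : (M <= j.+1 * k)%N -> (k <= M)%N -> A k.
  move=> h1 h2; apply: MA => //; rewrite (leq_trans h1)// leq_mul2r.
  by rewrite ltnS leq_maxl orbT.
have M0 : (0 < M)%N by rewrite (leq_ltn_trans _ jM).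
have := frequency_ge M0 MA' => fM.
apply: (@le_trans _ _ ((frequency R A M)%:E + e%:E)%E).
  by rewrite -EFinD lee_fin -lerBlDr (le_trans _ fM)// lerB// ltW.
rewrite leeD2r//; apply: ereal_sup_ubound; exists M => //=.
by rewrite ltnW// (leq_ltn_trans _ jM)// leq_maxr.
Qed.

Lemma lower_density_eq0 (A : set nat) :
  (forall j : nat, exists2 M, (j < M)%N &
    forall n, (M <= j.+1 * n)%N -> (n <= M)%N -> ~ A n) ->
  lower_density R A = 0%E.
Proof.
move=> HA; rewrite /lower_density limn_einf_lim.
suff -> : einfs (fun n => (frequency R A n)%:E) = cst 0%E by rewrite lim_cst.
apply/funext => n /=; apply/eqP; rewrite eq_le; apply/andP; split; last first.
  apply: le_ereal_inf_tmp => _ [m _ <-].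
  by rewrite lee_fin frequency_ge0.
apply/lee_addgt0Pr => e e0; rewrite add0e.
have [j je] : exists j : nat, j.+1%:R^-1 < e.
  exact: invS_lt.
have [M jM MA] := HA (maxn j n).
have MA' k : (M <= j.+1 * k)%N -> (k <= M)%N -> ~ A k.
  move=> h1 h2; apply: MA => //; rewrite (leq_trans h1)// leq_mul2r.
  by rewrite ltnS leq_maxl orbT.
have M0 : (0 < M)%N by rewrite (leq_ltn_trans _ jM).
have := frequency_le M0 MA' => fM.
apply: (@le_trans _ _ ((frequency R A M)%:E)).
  apply: ereal_inf_lbound; exists M => //=.
  by rewrite ltnW// (leq_ltn_trans _ jM)// leq_maxr.
by rewrite lee_fin (le_trans fM)// ltW.
Qed.

Lemma increasing_enumeration (A : set nat) : (forall m, exists2 n, A n & (m < n)%N) ->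
  exists n_ : nat -> nat,
    {homo n_ : k l / (k < l)%N} /\ range n_ = [set n | A n /\ (0 < n)%N].
Proof.
move=> Aoo.
have Aoob m : exists n, `[< A n >] && (m < n)%N.
  by have [n An mn] := Aoo m; exists n; rewrite mn andbT; apply/asboolP.
pose next m := ex_minn (Aoob m).
have nextP m : A (next m) /\ (m < next m)%N.
  by rewrite /next; case: ex_minnP => n /andP[/asboolP ? ?] _.
have next_le m n : A n -> (m < n)%N -> (next m <= n)%N.
  rewrite /next; case: ex_minnP => n' _ min An mn; apply: min.
  by rewrite mn andbT; apply/asboolP.
pose n_ k := iter k.+1 next 0%N.
have nlt k : (n_ k < n_ k.+1)%N by exact: (nextP _).2.
have nhomo : {homo n_ : k l / (k < l)%N} by apply: homo_ltn => //; exact: ltn_trans.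
have nge k : (k <= n_ k)%N.
  by elim: k => [//|k IH]; rewrite (leq_ltn_trans IH).
exists n_; split => //; apply/seteqP; split => [_ [k _ <-]|n [An n0]].
  split; first exact: (nextP _).1.
  by case: k => [|k]; [exact: (nextP _).2|rewrite (leq_ltn_trans _ (nlt k))].
have exk : exists k, (n <= n_ k)%N by exists n.
case: (ex_minnP exk) => -[|k] nk mink.
  by exists 0%N => //; apply/eqP; rewrite eqn_leq nk andbT; exact: next_le.
exists k.+1 => //; apply/eqP; rewrite eqn_leq nk andbT; apply: next_le => //.
by rewrite ltnNge; apply/negP => /mink; rewrite ltnn.
Qed.

(** Diagonal argument: enumerate the union of the windows for all $j$. The windows of index below
    $j$ are bounded, so a far enough term lies in a window of index $i \ge j$, and [P i] implies
    [P j]. *)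
Lemma density_one_sequence (P : nat -> nat -> Prop) :
  (forall j n, P j.+1 n -> P j n) ->
  (forall j : nat, exists2 M, (j < M)%N &
    forall n, (M <= j.+1 * n)%N -> (n <= M)%N -> P j n) ->
  exists n_ : nat -> nat, [/\ increasing_positive n_,
    upper_density R (range n_) = 1%E &
    forall j, exists k0, forall k, (k0 <= k)%N -> P j (n_ k)].
Proof.
move=> Pdec HP.
have /choice[M HM] : forall j, exists M, (j < M)%N /\
    forall n, (M <= j.+1 * n)%N -> (n <= M)%N -> P j n.
  by move=> j; have [M ? ?] := HP j; exists M.
pose A := [set n | exists2 j, (M j <= j.+1 * n)%N & (n <= M j)%N].
have [] := @increasing_enumeration A.
  move=> m; exists (M m); last exact: (HM m).1.
  by exists m => //; rewrite leq_pmull.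
move=> n_ [nhomo nA].
have npos k : (0 < n_ k)%N by have : range n_ (n_ k) by []; rewrite nA => -[].
have nge k : (k < n_ k)%N.
  by elim: k => [|k IH]; [exact: npos|rewrite (leq_ltn_trans IH)// nhomo].
exists n_; split=> [//||j].
  apply: upper_density_eq1 => j; exists (M j); first exact: (HM j).1.
  move=> n Mn nM; rewrite nA; split; first by exists j.
  rewrite lt0n; apply/eqP => n0; move: Mn (HM j).1; rewrite n0 muln0 leqn0.
  by move=> /eqP ->.
exists (\max_(i < j.+1) M i) => k jk.
have : range n_ (n_ k) by [].
rewrite nA => -[[i Mi iM] _].
have : (j <= i)%N.
  rewrite leqNgt; apply/negP => ij.
  have := @leq_bigmax 'I_j.+1 (fun i => M i) (Ordinal (ltnW ij : (i < j.+1)%N)).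
  by move=> /= h; have := leq_trans (nge k) (leq_trans iM (leq_trans h jk)); rewrite ltnn.
have := (HM i).2 _ Mi iM => + ji; rewrite -(subnKC ji).
elim: (i - j)%N => [|d IH]; rewrite ?addn0// addnS => /Pdec.
by [].
Qed.
End Densities.

(** * Hahn-Banach *)

Section HahnBanach.
Variables (R : realType) (K : numFieldType) (iota : {rmorphism R -> K}).
Variable V : lmodType K.
Implicit Types (p q h : V -> R) (x y u v : V).

Definition sublinear p :=
  [/\ p 0 = 0, forall u v, p (u + v) <= p u + p v &
      forall (r : R) u, 0 < r -> p (iota r *: u) <= r * p u].

Lemma sublinear_ge p u : sublinear p -> - p (- u) <= p u.
Proof. by case=> p0 pD _; have := pD u (- u); rewrite subrr p0; lra. Qed.

Lemma sublinearZ p r u : sublinear p -> 0 <= r -> p (iota r *: u) = r * p u.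
Proof.
case=> p0 _ pZ; rewrite le_eqVlt => /orP[/eqP <-|r0].
  by rewrite rmorph0 scale0r p0 mul0r.
apply/eqP; rewrite eq_le pZ//=.
have := pZ r^-1 (iota r *: u); rewrite invr_gt0 => /(_ r0).
rewrite scalerA -rmorphM mulVf ?gt_eqF// rmorph1 scale1r.
by rewrite ler_pdivlMl.
Qed.

Let inf_le (A : set R) (b a : R) : (forall c, A c -> b <= c) -> A a -> inf A <= a.
Proof. by move=> Ab Aa; apply: ge_inf => //; exists b. Qed.

(** Take $q(x) = \inf_{t \ge 0} (p(x+ty) - t\,p(y))$, which is finite because $-p(-x)$ is a lower
    bound; $t = 0$ and $t = 1$ give the two inequalities. *)
Lemma sublinear_shift p y : sublinear p -> exists q,
  [/\ sublinear q, forall x, q x <= p x & forall x, q x <= p (x + y) - p y].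
Proof.
move=> sp; have [p0 pD pZ] := sp.
pose S x := [set p (x + iota t *: y) - t * p y | t in [set t : R | 0 <= t]].
have Sge x b : S x b -> - p (- x) <= b.
  move=> [t /= t0 <-]; have := pD (x + iota t *: y) (- x).
  by rewrite addrAC subrr add0r sublinearZ//; lra.
have S_in x t : 0 <= t -> S x (p (x + iota t *: y) - t * p y) by exists t.
have qle x b : S x b -> inf (S x) <= b by move=> Sb; apply: (inf_le _ Sb) => c; exact: Sge.
have Sne x : S x !=set0 by exists (p (x + iota 0 *: y) - 0 * p y); exact: S_in.
exists (fun x => inf (S x)); split.
- split.
  + apply/eqP; rewrite eq_le; apply/andP; split.
      apply: qle; exists 0 => //=.
      by rewrite rmorph0 scale0r mul0r subr0 addr0.
    apply: lb_le_inf => // b /Sge; by rewrite oppr0 p0 oppr0.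
  + move=> u v; apply/ler_addgt0Pr => e e0.
    have [_ [s /= s0 <-] se] := @inf_adherent _ (S u) (e / 2)
      ltac:(by rewrite divr_gt0) ltac:(by split => //; exists (- p (- u)) => b /Sge).
    have [_ [t /= t0 <-] te] := @inf_adherent _ (S v) (e / 2)
      ltac:(by rewrite divr_gt0) ltac:(by split => //; exists (- p (- v)) => b /Sge).
    have := qle (u + v) _ (S_in (u + v) (s + t) (addr_ge0 s0 t0)).
    have := pD (u + iota s *: y) (v + iota t *: y).
    rewrite addrACA -scalerDl -rmorphD; lra.
  + move=> r u r0; rewrite -ler_pdivrMl//.
    apply: lb_le_inf => // _ [t /= t0 <-].
    rewrite ler_pdivrMl//.
    have := qle (iota r *: u) _ (S_in _ (r * t) (mulr_ge0 (ltW r0) t0)).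
    rewrite rmorphM -scalerA -scalerDr (sublinearZ _ sp (ltW r0)) => /le_trans; apply.
    by rewrite mulrBr mulrA.
- move=> x; have := qle x _ (S_in x 0 (lexx _)).
  by rewrite rmorph0 scale0r mul0r subr0 addr0.
- move=> x; have := qle x _ (S_in x 1 ler01).
  by rewrite rmorph1 scale1r mul1r.
Qed.

(** Zorn for the reversed pointwise order. The infimum of a chain stays subadditive because two
    members of the chain can be replaced by the smaller one, and it is finite because $-p_0(-x)$
    bounds the chain from below. *)
Lemma exists_minimal_sublinear p0 : sublinear p0 -> exists p,
  [/\ sublinear p, forall x, p x <= p0 x &
   forall q, sublinear q -> (forall x, q x <= p x) -> q = p].
Proof.
move=> sp0.
pose T := {p : V -> R | sublinear p /\ forall x, p x <= p0 x}.
pose le (a b : T) := `[< forall x, sval b x <= sval a x >].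
have [| | | |p pmin] := @Zorn T le.
- by move=> a; apply/asboolP.
- move=> a b c /asboolP ab /asboolP bc; apply/asboolP => x.
  exact: le_trans (bc x) (ab x).
- move=> [a Ha] [b Hb] /asboolP /= ab /asboolP /= ba; apply: eq_exist.
  by apply/funext => x; apply/eqP; rewrite eq_le ab ba.
(* The empty chain is bounded by $p_0$ itself; the infimum formula makes sense only for nonempty
   chains. *)
- move=> A totA; have [->|/set0P[a0 Aa0]] := eqVneq A set0.
    by exists (exist _ p0 (conj sp0 (fun=> lexx _))).
  pose S x := [set sval a x | a in A].
  have Sge x b : S x b -> - p0 (- x) <= b.
    move=> [a _ <-]; have [sa ap0] := svalP a.
    by have := sublinear_ge x sa; have := ap0 (- x); lra.
  have Sne x : S x !=set0 by exists (sval a0 x), a0.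
  have qle a x : A a -> inf (S x) <= sval a x.
    by move=> Aa; apply: (inf_le (fun c => @Sge x c)); exists a.
  have sq : sublinear (fun x => inf (S x)).
    split.
    + apply/eqP; rewrite eq_le; apply/andP; split.
        by have := qle _ 0 Aa0; have [[-> _ _] _] := svalP a0.
      by apply: lb_le_inf => // _ [a _ <-]; have [[-> _ _] _] := svalP a.
    + move=> u v; apply/ler_addgt0Pr => e e0.
      have [_ [a Aa <-] ae] := @inf_adherent _ (S u) (e / 2)
        ltac:(by rewrite divr_gt0) ltac:(by split => //; exists (- p0 (- u)) => b /Sge).
      have [_ [b Ab <-] be] := @inf_adherent _ (S v) (e / 2)
        ltac:(by rewrite divr_gt0) ltac:(by split => //; exists (- p0 (- v)) => b' /Sge).
      have [c [Ac ca cb]] : exists c, [/\ A c, forall x, sval c x <= sval a x &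
          forall x, sval c x <= sval b x].
        by have [/asboolP|/asboolP] := totA _ _ Aa Ab; [exists b|exists a].
      have := qle _ (u + v) Ac; have [[_ cD _] _] := svalP c.
      have := cD u v; have := ca u; have := cb v; lra.
    + move=> r u r0; rewrite -ler_pdivrMl//.
      apply: lb_le_inf => // _ [a Aa <-]; rewrite ler_pdivrMl//.
      have [[_ _ aZ] _] := svalP a.
      exact: le_trans (qle _ _ Aa) (aZ _ _ r0).
  have qp0 x : inf (S x) <= p0 x by apply: le_trans (qle _ x Aa0) ((svalP a0).2 x).
  exists (@exist (V -> R) _ _ (conj sq qp0)) => a Aa; apply/asboolP => x; exact: qle.
case: p pmin => p [sp pp0] pmin; exists p; split => // q sq qp.
have qp0 x : q x <= p0 x by exact: le_trans (qp x) (pp0 x).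
have := pmin (exist _ q (conj sq qp0)); rewrite /le asboolE => /(_ qp).
by move=> /(congr1 sval).
Qed.

(* A minimal sublinear functional p is linear: the shifted functional of
   [sublinear_shift] lies below p, hence equals p, so that
   [p x <= p (x + y) - p y]. *)
Lemma real_hahn_banach p0 x0 : sublinear p0 -> exists p,
  [/\ forall u v, p (u + v) = p u + p v,
      forall r u, p (iota r *: u) = r * p u,
      forall u, p u <= p0 u & p x0 = p0 x0].
Proof.
(* Minimality is sought below the shift of $p_0$ along $x_0$ and not below $p_0$: since $q_0(-x_0)
   \le -p_0(x_0)$, a linear $p \le q_0$ must satisfy $p(x_0) \ge p_0(x_0)$. *)
move=> sp0; have [q0 [sq0 q0p0 q0x0]] := sublinear_shift x0 sp0.
have [p [sp pq0 pmin]] := exists_minimal_sublinear sq0.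
have pp0 u : p u <= p0 u by exact: le_trans (pq0 u) (q0p0 u).
have pD u v : p (u + v) = p u + p v.
  have [q [sq qp qv]] := sublinear_shift v sp.
  have qE := pmin q sq qp; apply/eqP; rewrite eq_le; apply/andP; split.
    by have [_ + _] := sp; apply.
  by have := qv u; rewrite qE; lra.
have p_0 : p 0 = 0 by case: sp.
have pN u : p (- u) = - p u by have := pD u (- u); rewrite subrr p_0; lra.
exists p; split => //.
  move=> r u; have [r0|r0] := leP 0 r; first exact: sublinearZ.
  rewrite -[r]opprK rmorphN scaleNr pN sublinearZ ?oppr_ge0 1?ltW//.
  by rewrite -mulNr.
apply/eqP; rewrite eq_le pp0/=.
have := q0x0 (- x0); rewrite addNr; have [-> _ _] := sp0.
by have := pq0 (- x0); rewrite pN; lra.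
Qed.
End HahnBanach.

(** * Construction of the operator *)

(* The real and the complex case are treated together: iota embeds R in K, and
   norms, which take their values in K, are brought back to R by re. *)
Section Core.
Variables (R : realType) (K : numFieldType) (iota : {rmorphism R -> K}).
Variable re : K -> R.
Hypothesis iota_re : forall k : K, 0 <= k -> iota (re k) = k.
Hypothesis iota_le : forall a b : R, (iota a <= iota b) = (a <= b).
Variable X : completeNormedModType K.
Implicit Types (u v : X) (a b : K).

Definition av (a : K) : R := re `|a|.
Definition nm (x : X) : R := re `|x|.

Lemma iota_inj : injective iota.
Proof. by move=> r s rs; apply/eqP; rewrite eq_le -!iota_le rs lexx. Qed.

Lemma iota_lt (r s : R) : (iota r < iota s) = (r < s).
Proof. by rewrite !lt_neqAle iota_le (inj_eq iota_inj). Qed.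

Lemma avE a : `|a| = iota (av a). Proof. by rewrite /av iota_re. Qed.
Lemma nmE (x : X) : `|x| = iota (nm x). Proof. by rewrite /nm iota_re. Qed.

Lemma av_ge0 a : 0 <= av a. Proof. by rewrite -iota_le rmorph0 -avE. Qed.
Lemma nm_ge0 (x : X) : 0 <= nm x. Proof. by rewrite -iota_le rmorph0 -nmE. Qed.
Hint Resolve av_ge0 nm_ge0 : core.

Lemma avM a b : av (a * b) = av a * av b.
Proof. by apply: iota_inj; rewrite rmorphM -!avE normrM. Qed.

Lemma avD a b : av (a + b) <= av a + av b.
Proof. by rewrite -iota_le rmorphD -!avE ler_normD. Qed.

Lemma av_eq0 a : (av a == 0) = (a == 0).
Proof. by rewrite -(inj_eq iota_inj) rmorph0 -avE normr_eq0. Qed.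

Lemma av0 : av 0 = 0. Proof. by apply/eqP; rewrite av_eq0. Qed.

Lemma av_iota (r : R) : av (iota r) = `|r|.
Proof.
apply: iota_inj; rewrite -avE; have [r0|r0] := leP 0 r.
  by rewrite !ger0_norm// -(rmorph0 iota) iota_le.
rewrite [in RHS]ltr0_norm// -normrN -rmorphN ger0_norm//.
by rewrite -(rmorph0 iota) iota_le oppr_ge0 ltW.
Qed.

Lemma avN a : av (- a) = av a.
Proof. by rewrite /av normrN. Qed.

Lemma av_dist a b : `|av a - av b| <= av (a - b).
Proof.
have h1 : av a <= av (a - b) + av b by rewrite -{1}[a](subrK b) avD.
have h2 : av b <= av (a - b) + av a by rewrite -(avN (a - b)) opprB -{1}[b](subrK a) avD.
by rewrite ler_norml; apply/andP; split; lra.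
Qed.

Lemma av1 : av 1 = 1. Proof. by rewrite -(rmorph1 iota) av_iota normr1. Qed.

Lemma avV a : av a^-1 = (av a)^-1.
Proof. by apply: iota_inj; rewrite fmorphV -!avE normfV. Qed.

Lemma av_sum (I : Type) (s : seq I) (P : pred I) (F : I -> K) :
  av (\sum_(i <- s | P i) F i) <= \sum_(i <- s | P i) av (F i).
Proof.
elim/big_ind2 : _ => [|r1 a1 r2 a2 h1 h2|//]; first by rewrite av0.
by rewrite (le_trans (avD _ _))// lerD.
Qed.

Lemma av_prod (I : Type) (s : seq I) (P : pred I) (F : I -> K) :
  av (\prod_(i <- s | P i) F i) = \prod_(i <- s | P i) av (F i).
Proof. by apply: (big_morph av avM av1). Qed.

Lemma nmD (x y : X) : nm (x + y) <= nm x + nm y.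
Proof. by rewrite -iota_le rmorphD -!nmE ler_normD. Qed.

Lemma nmN (x : X) : nm (- x) = nm x. Proof. by rewrite /nm normrN. Qed.

Lemma nmB (x y : X) : nm (x - y) <= nm x + nm y.
Proof. by rewrite (le_trans (nmD _ _))// nmN. Qed.

Lemma nm_sub (x y z : X) : nm (x - y) <= nm (x - z) + nm (z - y).
Proof. by rewrite -[x - y](subrKA z) nmD. Qed.

Lemma nm_subC (x y : X) : nm (x - y) = nm (y - x).
Proof. by rewrite -nmN opprB. Qed.

Lemma nmZ a (x : X) : nm (a *: x) = av a * nm x.
Proof. by apply: iota_inj; rewrite rmorphM -avE -!nmE normrZ. Qed.

Lemma nm_eq0 (x : X) : (nm x == 0) = (x == 0).
Proof. by rewrite -(inj_eq iota_inj) rmorph0 -nmE normr_eq0. Qed.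

Lemma nm0 : nm 0 = 0. Proof. by apply/eqP; rewrite nm_eq0. Qed.

Lemma nm_sum (I : Type) (s : seq I) (P : pred I) (F : I -> X) :
  nm (\sum_(i <- s | P i) F i) <= \sum_(i <- s | P i) nm (F i).
Proof.
elim/big_ind2 : _ => [|r1 a1 r2 a2 h1 h2|//]; first by rewrite nm0.
by rewrite (le_trans (nmD _ _))// lerD.
Qed.

(** * Bounded functionals and finite biorthogonal systems *)

Definition functional (g : X -> K) (c : R) :=
  (forall a u v, g (a *: u + v) = a * g u + g v) /\
  (forall u, av (g u) <= c * nm u).

Section FunctionalTheory.
Variables (g : X -> K) (c : R).
Hypothesis gf : functional g c.

Lemma functional0 : g 0 = 0.
Proof. by have := gf.1 1 0 0; rewrite scaler0 addr0 mul1r => /eqP; rewrite -subr_eq subrr => /eqP <-. Qed.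

Lemma functionalD u v : g (u + v) = g u + g v.
Proof. by have := gf.1 1 u v; rewrite scale1r mul1r. Qed.

Lemma functionalZ a u : g (a *: u) = a * g u.
Proof. by have := gf.1 a u 0; rewrite functional0 !addr0. Qed.

Lemma functionalB u v : g (u - v) = g u - g v.
Proof. by rewrite functionalD -scaleN1r functionalZ mulN1r. Qed.

Lemma functional_sum (I : Type) (s : seq I) (P : pred I) (F : I -> X) :
  g (\sum_(i <- s | P i) F i) = \sum_(i <- s | P i) g (F i).
Proof. exact: (big_morph g functionalD functional0). Qed.
End FunctionalTheory.

Lemma functional_linear_comb n (a : 'I_n -> K) (f : 'I_n -> X -> K) (F : 'I_n -> R) :
  (forall i, functional (f i) (F i)) ->
  functional (fun v => \sum_i a i * f i v) (\sum_i av (a i) * F i).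
Proof.
move=> fF; split.
  move=> b u v; rewrite mulr_sumr -big_split/=; apply: eq_bigr => i _.
  by rewrite (fF i).1; ring.
move=> u; rewrite (le_trans (av_sum _ _ _))// mulr_suml ler_sum// => i _.
by rewrite avM -mulrA ler_wpM2l// (fF i).2.
Qed.

Lemma functional_add g h c d : functional g c -> functional h d ->
  functional (fun v => g v + h v) (c + d).
Proof.
move=> gc hd; split=> [a u v|u]; first by rewrite gc.1 hd.1; ring.
by rewrite (le_trans (avD _ _))// mulrDl lerD ?gc.2 ?hd.2.
Qed.

Lemma functional_ge0 g c (x : X) : functional g c -> x != 0 -> 0 <= c.
Proof.
move=> gc x0; have nx : 0 < nm x by rewrite lt_neqAle eq_sym nm_eq0 x0 nm_ge0.
by rewrite -(pmulr_lge0 _ nx) (le_trans (av_ge0 (g x)))// gc.2.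
Qed.

(** The form in which Hahn-Banach enters, proved at the end for real and for complex scalars. The
    bound [c] may be huge: large bounds are later outnumbered by a long block of well bounded
    functionals. *)
Hypothesis dual_separates : forall x : X, x != 0 ->
  exists g c, functional g c /\ g x = 1.

Definition biorthogonal n (x : nat -> X) (f : nat -> X -> K) (F : nat -> R) :=
  [/\ forall i, (i < n)%N -> nm (x i) <= 1,
      forall i, (i < n)%N -> functional (f i) (F i) &
      forall i j, (i < n)%N -> (j < n)%N -> f i (x j) = (i == j)%:R].

Definition in_span n (x : nat -> X) v :=
  exists a : nat -> K, v = \sum_(i < n) a i *: x i.

Definition residue n (x : nat -> X) (f : nat -> X -> K) v :=
  v - \sum_(i < n) f i v *: x i.

Section BiorthogonalTheory.
Variables (n : nat) (x : nat -> X) (f : nat -> X -> K) (F : nat -> R).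
Hypothesis xf : biorthogonal n x f F.

Lemma residue_functional i v : (i < n)%N -> f i (residue n x f v) = 0.
Proof.
move=> i_n; have [_ fF fx] := xf.
rewrite /residue (functionalB (fF i i_n)) (functional_sum (fF i i_n)).
rewrite (bigD1 (Ordinal i_n))//= big1 => [|j ji].
  by rewrite (functionalZ (fF i i_n)) fx// eqxx mulr1 addr0 subrr.
rewrite (functionalZ (fF i i_n)) fx// (_ : (i == j) = false) ?mulr0//.
by apply: contra_neqF ji => /eqP ij; apply: val_inj.
Qed.

Lemma nm_residue v : nm (residue n x f v) <= (1 + \sum_(i < n) F i) * nm v.
Proof.
have [x1 fF fx] := xf.
rewrite /residue (le_trans (nmB _ _))// mulrDl mul1r lerD2l.
rewrite (le_trans (nm_sum _ _ _))// mulr_suml ler_sum// => i _.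
rewrite nmZ (le_trans (ler_piMr _ (x1 i _)))//; exact: (fF i _).2.
Qed.

(** The new vector is the normalized residue $e$, which all $f_i$ kill. A functional $g$ with $g(e)
    = 1$ is corrected to $g - \sum_i g(x_i) f_i$; this vanishes at every $x_i$ and still takes the
    value 1 at $e$. *)
Lemma biorthogonal_extend v : residue n x f v != 0 ->
  exists x' f' F', [/\ biorthogonal n.+1 x' f' F',
    forall i, (i < n)%N -> [/\ x' i = x i, f' i = f i & F' i = F i] &
    in_span n.+1 x' v].
Proof.
set u := residue _ _ _ _ => u0; have [x1 fF fx] := xf.
have nu : nm u != 0 by rewrite nm_eq0.
have inu : iota (nm u) != 0 by rewrite fmorph_eq0.
pose e := (iota (nm u))^-1 *: u.
have e0 : e != 0 by rewrite scaler_eq0 invr_eq0 negb_or inu.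
have fe i : (i < n)%N -> f i e = 0.
  by move=> i_n; rewrite (functionalZ (fF i i_n)) residue_functional// mulr0.
have [g [c [gc ge]]] := dual_separates e0.
pose h v := g v + \sum_(i < n) (- g (x i)) * f i v.
have hf : functional h (c + \sum_(i < n) av (- g (x i)) * F i).
  by apply: (functional_add gc); apply: functional_linear_comb => i; apply: fF.
exists (fun i => if (i < n)%N then x i else e).
exists (fun i => if (i < n)%N then f i else h).
exists (fun i => if (i < n)%N then F i else c + \sum_(i < n) av (- g (x i)) * F i).
split.
- split.
  + move=> i _; case: ifP => [/x1//|_].
    rewrite /e nmZ avV av_iota ger0_norm// mulVf//.
  + by move=> i _; case: ifP => [/fF|].
  + move=> i j; rewrite !ltnS leq_eqVlt => /predU1P[->|i_n];
      rewrite leq_eqVlt => /predU1P[->|j_n].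
    * rewrite ltnn eqxx /h ge big1 ?addr0// => k _.
      by rewrite fe// mulr0.
    * rewrite ltnn j_n gtn_eqF// /h (bigD1 (Ordinal j_n))//= big1 => [|k kj].
        by rewrite fx// eqxx mulr1 addr0 subrr.
      rewrite fx// (_ : (_ == j) = false) ?mulr0//.
      by apply: contra_neqF kj => /eqP kj; apply: val_inj.
    * by rewrite i_n ltnn fe// ltn_eqF.
    * by rewrite i_n j_n fx.
- by move=> i ->.
- exists (fun i => if (i < n)%N then f i v else iota (nm u)).
  rewrite big_ord_recr/= ltnn /e scalerA divff// scale1r.
  under eq_bigr => i _ do rewrite ltn_ord.
  by rewrite /u /residue addrC subrK.
Qed.
End BiorthogonalTheory.

(** * Auerbach blocks and the infinite biorthogonal sequence *)

Hypothesis infinite_dim : ~ finite_dimensional X.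

Lemma not_in_span n x : exists v, ~ in_span n x v.
Proof.
apply: contrapT => H; apply: infinite_dim; exists n, (fun i : 'I_n => x i) => v.
have [a ->] : in_span n x v by apply: contrapT => h; apply: H; exists v.
by exists (fun i => a i).
Qed.

Lemma residue_eq0 n x f v : residue n x f v = 0 -> in_span n x v.
Proof. by move=> /eqP; rewrite subr_eq0 => /eqP ->; exists (fun i => f i v). Qed.

Definition agree n (x x' : nat -> X) (f f' : nat -> X -> K) (F F' : nat -> R) :=
  forall i, (i < n)%N -> [/\ x' i = x i, f' i = f i & F' i = F i].

Lemma biorthogonal_extend_n n x f F N : biorthogonal n x f F ->
  exists x' f' F', biorthogonal (n + N) x' f' F' /\ agree n x x' f f' F F'.
Proof.
move=> xf; elim: N => [|N [x1 [f1 [F1 [xf1 ag1]]]]].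
  by exists x, f, F; rewrite addn0; split => // i _.
have [v vS] := not_in_span (n + N) x1.
have [|x2 [f2 [F2 [xf2 ag2 _]]]] := biorthogonal_extend xf1 (v := v).
  by apply/eqP => /residue_eq0.
exists x2, f2, F2; rewrite addnS; split => // i i_n.
have [-> -> ->] := ag2 i (leq_trans i_n (leq_addr _ _)).
exact: ag1.
Qed.

Lemma nmZ_iotaV (u : X) : u != 0 -> nm ((iota (nm u))^-1 *: u) = 1.
Proof.
by move=> u0; rewrite nmZ avV av_iota ger0_norm// mulVf// nm_eq0.
Qed.

(* Auerbach: choose n vectors of norm at most 1 whose determinant against n
   independent functionals is maximal up to a factor 2; the dual functionals
   given by Cramer's rule are then bounded by 2. *)
Lemma auerbach (L : set X) N (g : 'I_N -> X -> K) (G : 'I_N -> R) (e : 'I_N -> X) :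
  (forall a u, L u -> L (a *: u)) ->
  (forall i, functional (g i) (G i)) ->
  (forall i, L (e i) /\ nm (e i) <= 1) ->
  (forall i j, g i (e j) = (i == j)%:R) ->
  exists (v : 'I_N -> X) (c : 'I_N -> 'I_N -> K),
    [/\ forall i, L (v i) /\ nm (v i) <= 1,
        forall i j, \sum_k c i k * g k (v j) = (i == j)%:R &
        forall i u, L u -> av (\sum_k c i k * g k u) <= 2 * nm u].
Proof.
move=> LZ gG Le ge.
pose M (v : 'I_N -> X) := \matrix_(i, j) g i (v j).
pose B := [set v : 'I_N -> X | forall i, L (v i) /\ nm (v i) <= 1].
pose S := [set av (\det (M v)) | v in B].
have G0 i : 0 <= G i.
  apply: (@functional_ge0 _ _ (e i) (gG i)); apply/eqP => ei0.
  have := ge i i; rewrite ei0 (functional0 (gG i)) eqxx => /esym/eqP.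
  by rewrite oner_eq0.
(* The Leibniz formula bounds all the determinants, so the supremum exists; the family $e$, whose
   matrix is the identity, shows that it is at least 1. *)
have S_ub r : S r -> r <= \sum_(s : 'S_N) \prod_i G i.
  move=> [v Bv <-]; rewrite (le_trans (av_sum _ _ _))// ler_sum// => s _.
  rewrite avM av_prod (_ : av _ = 1) ?mul1r; last first.
    by case: (odd_perm s); rewrite ?expr0 ?expr1 ?avN av1.
  apply: ler_prod => i _; rewrite av_ge0 mxE/=.
  rewrite (le_trans ((gG i).2 _))// ler_piMr//; exact: (Bv _).2.
have hasS : has_sup S.
  split; first by exists (av (\det (M e))), e.
  by exists (\sum_(s : 'S_N) \prod_i G i) => r /S_ub.
have supS1 : 1 <= sup S.
  apply: ub_le_sup => //; first by case: hasS.
  exists e => //; rewrite (_ : M e = 1%:M) ?det1 ?av1//.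
  by apply/matrixP => i j; rewrite !mxE ge.
have [_ [v Bv <-] vS] := @sup_adherent _ S (sup S / 2)
  ltac:(by rewrite divr_gt0// (lt_le_trans _ supS1)) hasS.
have {}vS : sup S / 2 < av (\det (M v)) by move: vS; lra.
have detv : 0 < av (\det (M v)) by rewrite (le_lt_trans _ vS)// divr_ge0// (le_trans _ supS1).
have detv0 : \det (M v) != 0 by rewrite -av_eq0 gt_eqF.
exists v, (fun i k => (\det (M v))^-1 * cofactor (M v) k i); split => //.
  move=> i j.
  have /matrixP/(_ i j) := mul_adj_mx (M v); rewrite !mxE => adjE.
  rewrite (eq_bigr (fun k => (\det (M v))^-1 * (\adj (M v) i k * M v k j))); last first.
    move=> k _; have -> : (\adj (M v)) i k = cofactor (M v) k i by rewrite mxE.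
    have -> : M v k j = g k (v j) by rewrite mxE.
    by ring.
  by rewrite -mulr_sumr adjE -[X in X *+ _]mulr1 -mulrnAr mulrA mulVf// mul1r.
move=> i u Lu.
have key w : L w -> nm w <= 1 ->
    av (\sum_k (\det (M v))^-1 * cofactor (M v) k i * g k w) <= 2.
  (* Replacing $v_i$ by $w$ gives another admissible family. By expansion along column $i$, the
     $i$-th dual functional at $w$ is $\det M(v') / \det M(v)$, where the numerator is at most $\sup
     S$ and the denominator exceeds $\sup S / 2$. *)
  move=> Lw w1; pose v' j := if j == i then w else v j.
  have Bv' : B v' by move=> j; rewrite /v'; case: eqP => // _; exact: Bv.
  have detE : \det (M v') = \sum_k g k w * cofactor (M v) k i.
    rewrite (expand_det_col _ i); apply: eq_bigr => k _.
    rewrite mxE /v' eqxx; congr (_ * (_ * \det _)).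
    apply/matrixP => a b; rewrite !mxE.
    by rewrite [_ == i]eq_sym (negbTE (neq_lift i b)).
  rewrite (_ : \sum_k _ = (\det (M v))^-1 * \det (M v')); last first.
    by rewrite detE mulr_sumr; apply: eq_bigr => k _; ring.
  rewrite avM avV mulrC ler_pdivrMr//.
  have : av (\det (M v')) <= sup S.
    by apply: ub_le_sup; [case: hasS|exists v'].
  by move: vS; lra.
have [->|u0] := eqVneq u 0.
  rewrite big1 ?av0 ?nm0 ?mulr0// => k _.
  by rewrite (functional0 (gG k)) mulr0.
have nu : 0 < nm u by rewrite lt_neqAle eq_sym nm_eq0 u0 nm_ge0.
have := key ((iota (nm u))^-1 *: u) (LZ _ _ Lu); rewrite nmZ_iotaV// => /(_ (lexx _)).
rewrite (eq_bigr (fun k => (iota (nm u))^-1 *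
    ((\det (M v))^-1 * cofactor (M v) k i * g k u))); last first.
  by move=> k _; rewrite (functionalZ (gG k)); ring.
rewrite -mulr_sumr avM avV av_iota ger0_norm// mulrC ler_pdivrMr//.
Qed.

(** The Auerbach step takes place in the common kernel of the first $n$ functionals. The functionals
    obtained vanish at the old vectors, so they see $u$ only through its residue, whose norm is at
    most $(1 + \sum_{i<n} F_i)\|u\|$. The point is that [C] is fixed before the block length $N$. *)
Lemma biorthogonal_extend_block n x f F : biorthogonal n x f F ->
  exists C : R, forall N, exists x' f' F',
    [/\ biorthogonal (n + N) x' f' F', agree n x x' f f' F F' &
        forall i, (n <= i < n + N)%N -> F' i <= C].
Proof.
move=> xf; exists (2 * (1 + \sum_(i < n) F i)) => N.
have [x1 [f1 [F1 [xf1 ag]]]] := biorthogonal_extend_n N xf.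
have [x11 fF1 fx1] := xf1; have [x01 fF fx] := xf.
pose L := [set u : X | forall i, (i < n)%N -> f i u = 0].
have nN (i : 'I_N) : (n + i < n + N)%N by rewrite ltn_add2l.
have nlt i : (i < n)%N -> (i < n + N)%N by move=> h; rewrite (leq_trans h)// leq_addr.
have [] := @auerbach L N (fun i => f1 (n + i)%N) (fun i => F1 (n + i)%N)
   (fun i => x1 (n + i)%N).
- by move=> a u Lu i i_n; rewrite (functionalZ (fF i i_n)) Lu// mulr0.
- by move=> i; apply: fF1.
- move=> i; split; last exact: x11.
  move=> j jn; have [_ <- _] := ag j jn.
  rewrite fx1//; last exact: nlt.
  by rewrite (_ : (_ == _) = false)// ltn_eqF// (leq_trans jn)// leq_addr.
- by move=> i j; rewrite fx1// eqn_add2l.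
move=> v [c [vL cv cb]].
have [N0|N0] := posnP N.
  exists x, f, F; rewrite N0 addn0; split => // i /andP[h1 h2].
  by move: (leq_ltn_trans h1 h2); rewrite ltnn.
pose i0 := Ordinal N0.
pose o i : 'I_N := insubd i0 (i - n)%N.
have oE (i : 'I_N) : o (n + i)%N = i.
  by apply: val_inj; rewrite /= /o val_insubd addKn ltn_ord.
pose h i u := \sum_k c i k * f1 (n + k)%N u.
have hf i : functional (h i) (\sum_k av (c i k) * F1 (n + k)%N).
  by apply: (@functional_linear_comb _ (c i) (fun k => f1 (n + k)%N)) => k; exact: fF1.
have hx i j : (j < n)%N -> h i (x j) = 0.
  move=> jn; rewrite /h big1// => k _; have [<- _ _] := ag j jn.
  rewrite fx1//; last exact: nlt.
  by rewrite (_ : (_ == _) = false) ?mulr0// gtn_eqF// (leq_trans jn)// leq_addr.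
have hb i : functional (h i) (2 * (1 + \sum_(i < n) F i)).
  split; first exact: (hf i).1.
  move=> u; have -> : h i u = h i (residue n x f u).
    rewrite /residue (functionalB (hf i)) (functional_sum (hf i)).
    rewrite big1 ?subr0// => j _; by rewrite (functionalZ (hf i)) hx// mulr0.
  rewrite (le_trans (cb i _ _))//.
    by move=> j jn; apply: (residue_functional xf).
  by rewrite -mulrA ler_pM2l//; apply: (nm_residue xf).
have split_idx i : (i < n + N)%N -> (i < n)%N \/ exists k : 'I_N, i = (n + k)%N.
  move=> inN; have [|ni] := ltnP i n; [by left|right].
  have iN : (i - n < N)%N by rewrite ltn_subLR.
  by exists (Ordinal iN); rewrite /= subnKC.
exists (fun i => if (i < n)%N then x i else v (o i)).
exists (fun i => if (i < n)%N then f i else h (o i)).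
exists (fun i => if (i < n)%N then F i else 2 * (1 + \sum_(i < n) F i)).
split.
- split.
  + move=> i _; case: ifP => [/x01//|_]; exact: (vL _).2.
  + move=> i _; case: ifP => [/fF//|_]; exact: hb.
  + move=> i j /split_idx[i_n|[k ->]] /split_idx[jn|[l ->]].
    * by rewrite i_n jn fx.
    * rewrite i_n ltnNge leq_addr/= (vL _).1//.
      by rewrite (_ : (_ == _) = false)// ltn_eqF// (leq_trans i_n)// leq_addr.
    * rewrite jn ltnNge leq_addr/= hx//.
      by rewrite (_ : (_ == _) = false)// gtn_eqF// (leq_trans jn)// leq_addr.
    * by rewrite !(ltnNge (n + _)) !leq_addr/= !oE /h cv eqn_add2l.
- by move=> i ->.
- by move=> i /andP[ni _]; rewrite ltnNge ni.
Qed.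

(* Size, vectors, functionals and bounds; the sequences are irrelevant beyond
   the size. *)
Definition system := (nat * (nat -> X) * (nat -> X -> K) * (nat -> R))%type.
Definition ssize (s : system) := s.1.1.1.
Definition svec (s : system) := s.1.1.2.
Definition sfun (s : system) := s.1.2.
Definition sbnd (s : system) := s.2.
Definition sgood (s : system) := biorthogonal (ssize s) (svec s) (sfun s) (sbnd s).

(** After [d] has been put in the span, append a block of length $b+1$, where $b$ exceeds the block
    constant, all earlier bounds and $k$. At the last index $N = n_1 + b$ every functional so far is
    then bounded by $N$. *)
Lemma biorthogonal_step (d : X) (k : nat) (s : system) : sgood s ->
  exists s', [/\ sgood s', (ssize s < ssize s')%N,
    agree (ssize s) (svec s) (svec s') (sfun s) (sfun s') (sbnd s) (sbnd s'),
    in_span (ssize s') (svec s') d &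
    exists2 N, (k <= N < ssize s')%N & forall i, (i <= N)%N -> sbnd s' i <= N%:R].
Proof.
case: s => [[[n x] f] F]; rewrite /sgood /= => xf.
have [n1 [x1 [f1 [F1 [xf1 n1n ag1 sp1]]]]] : exists n1 x1 f1 F1,
   [/\ biorthogonal n1 x1 f1 F1, (n <= n1)%N, agree n x x1 f f1 F F1 &
       in_span n1 x1 d].
  have [r0|r0] := eqVneq (residue n x f d) 0.
    by exists n, x, f, F; split => //; exact: residue_eq0 r0.
  have [x1 [f1 [F1 [xf1 ag1 sp]]]] := biorthogonal_extend xf r0.
  by exists n.+1, x1, f1, F1.
have [C HC] := biorthogonal_extend_block xf1.
pose b := (Num.truncn `|C| + \sum_(i < n1) Num.truncn `|F1 i| + k).+1.
have [x2 [f2 [F2 [xf2 ag2 bd2]]]] := HC b.+1.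
exists ((n1 + b.+1)%N, x2, f2, F2); rewrite /ssize /svec /sfun /sbnd /=; split => //.
- by rewrite (leq_ltn_trans n1n)// addnS ltnS leq_addr.
- move=> i i_n; have [-> -> ->] := ag2 i (leq_trans i_n n1n); exact: ag1.
- have [a ->] := sp1; exists (fun i => if (i < n1)%N then a i else 0).
  rewrite big_split_ord/= [X in _ + X]big1 ?addr0 => [|i _]; last first.
    by rewrite ltnNge leq_addr/= scale0r.
  apply: eq_bigr => i _; rewrite ltn_ord.
  by have [-> _ _] := ag2 i (ltn_ord i).
- exists (n1 + b)%N.
    by rewrite addnS leqnn andbT /b addnS ltnW// ltnS !addnA leq_addl.
  move=> i ib.
  have le_b (r : R) m : (Num.truncn `|r| + m <= b.-1)%N -> r <= (n1 + b)%:R.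
    move=> rm; rewrite (le_trans (ler_norm r))// ltW//.
    rewrite (lt_le_trans (truncnS_gt _))// ler_nat.
    by rewrite (leq_trans _ (leq_addl _ _))// /b ltnS (leq_trans _ rm)// leq_addr.
  have [i1|n1i] := ltnP i n1.
    have [_ _ ->] := ag2 i i1.
    apply: (le_b _ 0%N); rewrite addn0 /b/= -addnA addnCA (leq_trans _ (leq_addr _ _))//.
    by rewrite (bigD1 (Ordinal i1))//= leq_addr.
  apply: le_trans (bd2 i _) _; first by rewrite n1i addnS ltnS.
  by apply: (le_b _ (\sum_(i < n1) Num.truncn `|F1 i| + k)%N); rewrite /b/= addnA.
Qed.

Lemma exists_biorthogonal_sequence (d : nat -> X) :
  exists (x : nat -> X) (f : nat -> X -> K) (F : nat -> R),
  [/\ forall n, biorthogonal n x f F, forall k, exists n, in_span n x (d k) &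
      forall k, exists2 N, (k <= N)%N & forall i, (i <= N)%N -> F i <= N%:R].
Proof.
pose P k (s s' : {s | sgood s}) :=
  [/\ (ssize (sval s) < ssize (sval s'))%N,
    agree (ssize (sval s)) (svec (sval s)) (svec (sval s')) (sfun (sval s)) (sfun (sval s'))
      (sbnd (sval s)) (sbnd (sval s')),
    in_span (ssize (sval s')) (svec (sval s')) (d k) &
    exists2 N, (k <= N < ssize (sval s'))%N &
      forall i, (i <= N)%N -> sbnd (sval s') i <= N%:R].
have /choice[nxt nxtP] : forall p : nat * {s | sgood s}, exists s', P p.1 p.2 s'.
  move=> [k [s sg]]; have [s' [sg' ? ? ? ?]] := biorthogonal_step (d k) k sg.
  by exists (exist _ s' sg').
have s0 : sgood (0%N, fun=> 0, fun _ _ => 0, fun=> 0) by split.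
pose fix S k := if k is k'.+1 then nxt (k', S k') else exist _ _ s0.
have SP k : P k (S k) (S k.+1) := nxtP (k, S k).
have size_ge k : (k <= ssize (sval (S k)))%N.
  elim: k => // k IH; have [h _ _ _] := SP k; exact: leq_ltn_trans IH h.
have size_mono k l : (k <= l)%N -> (ssize (sval (S k)) <= ssize (sval (S l)))%N.
  move=> /subnKC <-; elim: (l - k)%N => [|m IH]; first by rewrite addn0.
  have [h _ _ _] := SP (k + m)%N; rewrite addnS; exact: leq_trans IH (ltnW h).
have ag k l i : (k <= l)%N -> (i < ssize (sval (S k)))%N ->
    [/\ svec (sval (S l)) i = svec (sval (S k)) i,
        sfun (sval (S l)) i = sfun (sval (S k)) i &
        sbnd (sval (S l)) i = sbnd (sval (S k)) i].
  move=> /subnKC <-; elim: (l - k)%N => [|m IH] ik; first by rewrite addn0.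
  have [_ h _ _] := SP (k + m)%N; rewrite addnS.
  have [-> -> ->] := h i (leq_trans ik (size_mono _ _ (leq_addr _ _))).
  exact: IH.
(* Stage $i+1$ has size at least $i+1$ and later stages agree with it there, so the entry of index
   $i$ is final. *)
pose x i := svec (sval (S i.+1)) i; pose f i := sfun (sval (S i.+1)) i.
pose F i := sbnd (sval (S i.+1)) i.
have limE k i : (i < ssize (sval (S k)))%N ->
    [/\ x i = svec (sval (S k)) i, f i = sfun (sval (S k)) i &
        F i = sbnd (sval (S k)) i].
  move=> ik; have ii := size_ge i.+1; rewrite /x /f /F.
  have [<- <- <-] := ag k (maxn k i.+1) i (leq_maxl _ _) ik.
  by have [-> -> ->] := ag i.+1 (maxn k i.+1) i (leq_maxr _ _) ii.
exists x, f, F; split.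
- move=> n; have [x1 fF fx] := svalP (S n).
  have ns i : (i < n)%N -> (i < ssize (sval (S n)))%N.
    by move=> h; rewrite (leq_trans h).
  split.
  + by move=> i /ns i_n; have [-> _ _] := limE _ _ i_n; exact: x1.
  + by move=> i /ns i_n; have [_ -> ->] := limE _ _ i_n; exact: fF.
  + move=> i j /ns i_n /ns jn; have [_ -> _] := limE _ _ i_n.
    by have [-> _ _] := limE _ _ jn; exact: fx.
- move=> k; exists (ssize (sval (S k.+1))).
  have [_ _ [a ->] _] := SP k; exists a; apply: eq_bigr => i _.
  by have [-> _ _] := limE k.+1 i (ltn_ord i).
- move=> k; have [_ _ _ [N /andP[kN Ns] bN]] := SP k; exists N => // i iN.
  by have [_ _ ->] := limE k.+1 i (leq_ltn_trans iN Ns); exact: bN.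
Qed.

Lemma complete_limit (u : nat -> X) (c : R) :
  (forall m n, (m <= n)%N -> nm (u n - u m) <= c / m.+1%:R) ->
  exists l, forall m, nm (l - u m) <= c / m.+1%:R.
Proof.
move=> uc.
have small e : 0 < e -> exists m : nat, c / m.+1%:R < e.
  move=> e0; have [c0|c0] := leP c 0.
    by exists 0%N; rewrite invr1 mulr1 (le_lt_trans c0).
  have [m me] := invS_lt (divr_gt0 e0 c0); exists m.
  by rewrite mulrC -ltr_pdivlMr.
have ucvg : cvg (u @ \oo).
  apply/cauchy_cvgP/cauchy_exP => e e0.
  have re0 : 0 < re e by rewrite -iota_lt rmorph0 iota_re// ltW.
  have [m me] := small _ re0.
  exists (u m); exists m => // n /= mn.
  rewrite -ball_normE /= nmE -(iota_re (ltW e0)) iota_lt.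
  by rewrite nm_subC (le_lt_trans (uc _ _ mn)).
have /cvgrPdist_lt ul : u @ \oo --> lim (u @ \oo) by [].
exists (lim (u @ \oo)) => m; apply/ler_addgt0Pr => e e0.
have ie0 : 0 < iota e by rewrite -(rmorph0 iota) iota_lt.
have [n0 _ n0P] := ul _ ie0.
have /= := n0P (maxn n0 m) (leq_maxl _ _).
rewrite nmE iota_lt => h.
rewrite (le_trans (nm_sub _ _ (u (maxn n0 m))))// addrC lerD//; last exact: ltW.
exact/uc/leq_maxr.
Qed.

Lemma le0_of_le_divS (r c : R) : (forall m : nat, r <= c / m.+1%:R) -> r <= 0.
Proof.
move=> rc; rewrite leNgt; apply/negP => r0.
have c0 : 0 < c by have := rc 0%N; rewrite invr1 mulr1; apply: lt_le_trans.
have [m] := invS_lt (divr_gt0 r0 c0); rewrite ltr_pdivlMr// mulrC => h.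
by have := rc m; rewrite leNgt h.
Qed.

(** * The nuclear weighted backward shift *)

Section ShiftOperator.
Variables (x : nat -> X) (f : nat -> X -> K) (F : nat -> R).
Hypothesis xf : forall n, biorthogonal n x f F.

(** The factor $(i+1)(i+2)$ makes the nuclear bounds $w_i F_{i+1} \le 1/(i+1) - 1/(i+2)$ telescope:
    the tails are at most $1/(m+1)$ and the total is at most 1, whence $\|S\| \le 1$. The maximum
    with 1 keeps the weight positive. *)
Let weight (i : nat) : R := (i.+1%:R * i.+2%:R * Num.max 1 (F i.+1))^-1.
Let P m v := \sum_(i < m) (iota (weight i) * f i.+1 v) *: x i.

Let max_ge1 i : 1 <= Num.max 1 (F i). Proof. by rewrite le_max lexx. Qed.

Let weight_gt0 i : 0 < weight i.
Proof. by rewrite invr_gt0 !mulr_gt0// (lt_le_trans _ (max_ge1 _)). Qed.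

Let fF i : functional (f i) (F i).
Proof. by have [_ h _] := xf i.+1; exact: h. Qed.

Let nmx i : nm (x i) <= 1.
Proof. by have [h _ _] := xf i.+1; exact: h. Qed.

Let fx i j : f i (x j) = (i == j)%:R.
Proof.
have [_ _ h] := xf (maxn i j).+1.
by apply: h; rewrite ltnS ?leq_maxl ?leq_maxr.
Qed.

Let weightF i : weight i * F i.+1 <= i.+1%:R^-1 - i.+2%:R^-1.
Proof.
have i1 : i.+1%:R != 0 :> R by rewrite pnatr_eq0.
have i2 : i.+2%:R != 0 :> R by rewrite pnatr_eq0.
have -> : i.+1%:R^-1 - i.+2%:R^-1 = (i.+1%:R * i.+2%:R)^-1 :> R.
  have e : i.+2%:R = i.+1%:R + 1 :> R by rewrite natr1.
  by rewrite e in i2 *; move: i1 i2; move: (i.+1%:R) => r r1 r2; field; rewrite r1 r2.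
rewrite /weight invfM -mulrA ler_piMr ?invr_ge0 ?mulr_ge0//.
by rewrite ler_pdivrMl ?mulr1 ?le_max ?lexx ?orbT// (lt_le_trans _ (max_ge1 _)).
Qed.

Let P_cauchy v m n : (m <= n)%N -> nm (P n v - P m v) <= nm v / m.+1%:R.
Proof.
move=> mn; suff : nm (P n v - P m v) <= nm v * (m.+1%:R^-1 - n.+1%:R^-1).
  move=> /le_trans; apply; rewrite ler_wpM2l ?nm_ge0// gerBl invr_ge0//.
rewrite -(subnKC mn); elim: (n - m)%N => [|d IH].
  by rewrite addn0 !subrr nm0 mulr0.
rewrite addnS; have -> : P (m + d).+1 v - P m v =
   (P (m + d)%N v - P m v) + (iota (weight (m + d)) * f (m + d).+1 v) *: x (m + d).
  by rewrite /P big_ord_recr/= addrAC.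
rewrite (le_trans (nmD _ _))//.
have -> : m.+1%:R^-1 - (m + d).+2%:R^-1 = (m.+1%:R^-1 - (m + d).+1%:R^-1) +
  ((m + d).+1%:R^-1 - (m + d).+2%:R^-1) :> R by rewrite subrKA.
rewrite mulrDr lerD//.
rewrite nmZ (le_trans (ler_piMr (av_ge0 _) (nmx _)))//.
rewrite avM av_iota gtr0_norm// (le_trans (ler_wpM2l _ ((fF _).2 v)))//; first exact: ltW.
by rewrite mulrA mulrC; apply: ler_wpM2l; rewrite ?nm_ge0.
Qed.

(** Dividing $x_m$ by the product of the first $m$ weights turns $S x_{m+1} = w_m x_m$ into $S
    y_{m+1} = y_m$. *)
Let scaled m := (iota (\prod_(i < m) weight i))^-1 *: x m.

(** [b k] collects the first $k$ inverse weights, so that for fixed $k$ only the $j$ following ones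
    are charged to $N$. The functional [f0] is the coordinate functional of $x_0 = y_0$. *)
Lemma exists_shift_operator (d : nat -> X) :
  (forall v (e : R), 0 < e -> exists k, nm (v - d k) < e) ->
  (forall k, exists n, in_span n x (d k)) ->
  (forall k, exists2 N, (k <= N)%N & forall i, (i <= N)%N -> F i <= N%:R) ->
  exists (S : X -> X) (y : nat -> X) (f0 : X -> K) (c0 : R) (b : nat -> R),
  [/\ (forall a u v, S (a *: u + v) = a *: S u + S v) /\ (forall v, nm (S v) <= nm v),
      S (y 0%N) = 0 /\ forall m, S (y m.+1) = y m,
      functional f0 c0 /\ forall m, f0 (y m) = (m == 0%N)%:R,
      forall v (e : R), 0 < e -> exists n s, in_span n y s /\ nm (v - s) < e &
      (forall k, 0 <= b k) /\ forall J, exists2 N, (J <= N)%N &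
        forall k j, (k + j <= N)%N -> nm (y (k + j)%N) <= b k * N.+1%:R ^+ (3 * j)].
Proof.
move=> d_dense d_span F_small.
have /choice[S SP] : forall v, exists l, forall m, nm (l - P m v) <= nm v / m.+1%:R.
  by move=> v; apply: complete_limit => m n; exact: P_cauchy.
have P0 v : P 0%N v = 0 by rewrite /P big_ord0.
have SD a u v : S (a *: u + v) = a *: S u + S v.
  apply/eqP; rewrite -subr_eq0 -nm_eq0 eq_le nm_ge0 andbT.
  (* The partial sums are linear and approximate $S$ at rate $1/(m+1)$, so the linearity defect is
     below every multiple $c/(m+1)$. *)
  apply: (@le0_of_le_divS _ (nm (a *: u + v) + av a * nm u + nm v)) => m.
  have PD : P m (a *: u + v) = a *: P m u + P m v.
    rewrite /P scaler_sumr -big_split/=; apply: eq_bigr => i _.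
    by rewrite (fF i.+1).1 scalerA -scalerDl; congr (_ *: _); ring.
  rewrite !mulrDl -mulrA.
  have -> : S (a *: u + v) - (a *: S u + S v) =
    (S (a *: u + v) - P m (a *: u + v)) - a *: (S u - P m u) - (S v - P m v).
    rewrite PD scalerBr; move: (S _) (a *: S u) (S v) (a *: P m u) (P m v) => p q r s t.
    have E q' r' : p - ((q' + s) + (r' + t)) = p - (s + t) - q' - r'.
      by rewrite addrACA [_ + (s + t)]addrC !opprD !addrA.
    by have := E (q - s) (r - t); rewrite !subrK.
  rewrite (le_trans (nmB _ _))// lerD ?SP// (le_trans (nmB _ _))// lerD ?SP//.
  by rewrite nmZ ler_wpM2l ?av_ge0// SP.
have SZ a u : S (a *: u) = a *: S u.
  have := SD a u 0; rewrite !addr0 => ->; rewrite [S 0](_ : _ = 0) ?addr0//.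
  by apply/eqP; rewrite -nm_eq0 eq_le nm_ge0 andbT; have := SP 0 0%N;
    rewrite P0 subr0 nm0 mul0r.
have Sx v w m0 : (forall m, (m0 <= m)%N -> P m v = w) -> S v = w.
  move=> Pv; apply/eqP; rewrite -subr_eq0 -nm_eq0 eq_le nm_ge0 andbT.
  apply: (@le0_of_le_divS _ (nm v)) => m.
  rewrite -(Pv (maxn m0 m)) ?leq_maxl// (le_trans (SP _ _))//.
  by rewrite ler_wpM2l ?nm_ge0// lef_pV2 ?posrE// ler_nat ltnS leq_maxr.
have prod_gt0 m : 0 < \prod_(i < m) weight i by apply: prodr_gt0.
exists S, scaled, (f 0%N), (F 0%N), (fun k => (\prod_(i < k) weight i)^-1); split.
- split => // v; have := SP v 0%N.
  by rewrite P0 subr0 invr1 mulr1.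
- split.
    rewrite SZ (Sx _ 0 0%N) ?scaler0// => m _; rewrite /P big1// => i _.
    by rewrite fx mulr0 scale0r.
  move=> m; rewrite SZ (Sx _ (iota (weight m) *: x m) m.+1).
    rewrite /scaled scalerA big_ord_recr/= rmorphM invfM -mulrA mulVf ?mulr1//.
    by rewrite fmorph_eq0 gt_eqF.
  move=> n mn; rewrite /P (bigD1 (Ordinal mn))//= big1 => [|i im].
    by rewrite fx eqxx mulr1 addr0.
  rewrite fx (_ : (_ == _) = false) ?mulr0 ?scale0r//.
  by apply: contra_neqF im => /eqP[im]; apply: val_inj.
- split=> [|m]; first exact: fF.
  rewrite /scaled (functionalZ (fF 0%N)) fx eq_sym; case: eqP => [->|_]; last by rewrite mulr0.
  by rewrite big_ord0 rmorph1 invr1 mul1r.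
- move=> v e e0; have [k vk] := d_dense v e e0; have [n [a dk]] := d_span k.
  exists n, (d k); split => //; exists (fun i => a i * iota (\prod_(i < i) weight i)).
  rewrite dk; apply: eq_bigr => i _; rewrite /scaled scalerA mulfK//.
  by rewrite fmorph_eq0 gt_eqF.
- split=> [k|J]; first by rewrite invr_ge0 ltW.
  have [N JN FN] := F_small J; exists N => // k j kj.
  have nms m : nm (scaled m) <= (\prod_(i < m) weight i)^-1.
    by rewrite nmZ avV av_iota gtr0_norm// ler_piMr// invr_ge0 ltW.
  rewrite (le_trans (nms _))//.
  elim: j kj => [|j IH] kj; first by rewrite addn0 muln0 expr0 mulr1.
  rewrite addnS in kj *; rewrite big_ord_recr/= invfM mulnS [(3 + _)%N]addnC exprD mulrA.
  have pV m : 0 <= (\prod_(i < m) weight i)^-1 by rewrite invr_ge0 ltW.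
  have wV i : 0 <= (weight i)^-1 by rewrite invr_ge0 ltW.
  apply: (ler_pM (pV _) (wV _) (IH (ltnW kj))).
  rewrite /weight invrK exprSr expr2; apply: ler_pM => //; last 2 first.
  + by apply: ler_pM; rewrite // ler_nat ltnS// ltnW.
  + by rewrite ge_max ler1n (le_trans (FN _ kj))// ler_nat.
  + by rewrite (le_trans _ (max_ge1 _)).
Qed.
End ShiftOperator.

(** * Orbits of the operator I + S *)

Section Dynamics.
Variables (S : X -> X) (y : nat -> X) (f0 : X -> K) (c0 : R) (b : nat -> R).
Hypothesis S_linear : forall a u v, S (a *: u + v) = a *: S u + S v.
Hypothesis S_bound : forall v, nm (S v) <= nm v.
Hypothesis S_y0 : S (y 0%N) = 0.
Hypothesis S_yS : forall m, S (y m.+1) = y m.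
Hypothesis f0_functional : functional f0 c0.
Hypothesis f0_y : forall m, f0 (y m) = (m == 0%N)%:R.
Hypothesis y_dense : forall v (e : R), 0 < e ->
  exists n s, in_span n y s /\ nm (v - s) < e.
Hypothesis b_ge0 : forall k, 0 <= b k.

(* The exponent 3 comes from weight (i)^-1 <= (N + 1)^3 for i < N, when the
   functionals up to N are bounded by N. *)
Definition slow_growth N :=
  forall k j, (k + j <= N)%N -> nm (y (k + j)%N) <= b k * N.+1%:R ^+ (3 * j).
Hypothesis slow_growth_often : forall J, exists2 N, (J <= N)%N & slow_growth N.

Let T v := v + S v.

Section IterTheory.
Variable U : X -> X.
Hypothesis U_linear : forall a u v, U (a *: u + v) = a *: U u + U v.

Lemma iter_linear n a u v : iter n U (a *: u + v) = a *: iter n U u + iter n U v.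
Proof. by elim: n => [//|n IH]; rewrite !iterS IH U_linear. Qed.

Lemma linear_funD u v : U (u + v) = U u + U v.
Proof. by have := U_linear 1 u v; rewrite !scale1r. Qed.

Lemma linear_fun0 : U 0 = 0.
Proof. by have := linear_funD 0 0; rewrite addr0 => /eqP; rewrite -subr_eq0 opprD addrA subrr sub0r oppr_eq0 => /eqP. Qed.

Lemma linear_funZ a u : U (a *: u) = a *: U u.
Proof. by have := U_linear a u 0; rewrite linear_fun0 !addr0. Qed.

Lemma linear_funB u v : U (u - v) = U u - U v.
Proof. by rewrite addrC -scaleN1r U_linear scaleN1r addrC. Qed.

Lemma linear_fun_sum (I : Type) (s : seq I) (P : pred I) (F : I -> X) :
  U (\sum_(i <- s | P i) F i) = \sum_(i <- s | P i) U (F i).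
Proof. exact: (big_morph U linear_funD linear_fun0). Qed.
End IterTheory.

Lemma T_linear a u v : T (a *: u + v) = a *: T u + T v.
Proof. by rewrite /T S_linear scalerDr addrACA. Qed.

Lemma T_bound v : nm (T v) <= 2 * nm v.
Proof. by rewrite (le_trans (nmD _ _))// mulr_natl mulr2n lerD. Qed.

Lemma iter_T_bound n v : nm (iter n T v) <= 2 ^+ n * nm v.
Proof.
elim: n => [|n IH]; first by rewrite expr0 mul1r.
by rewrite iterS (le_trans (T_bound _))// exprS -mulrA ler_pM2l.
Qed.

Lemma iter_S_bound n v : nm (iter n S v) <= nm v.
Proof. by elim: n => [//|n IH]; rewrite iterS (le_trans (S_bound _)). Qed.

(* The vector whose orbit under T has coordinates given by the successive
   differences of g: in the basis y, T acts as the translation by 1. *)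
Definition newton N (g : R -> R) (c : R) : X :=
  \sum_(m < N.+1) iota (iter m (@diff R) g c) *: y m.

Lemma T_newton N g c : diff_degree g N -> T (newton N g c) = newton N g (c + 1).
Proof.
move=> gN; rewrite /newton.
have E m : iter m (@diff R) g (c + 1) = iter m (@diff R) g c + iter m.+1 (@diff R) g c.
  by rewrite diffS addrCA subrr addr0.
under [RHS]eq_bigr => m _ do rewrite E rmorphD scalerDl.
rewrite big_split/= {1}/T; congr (_ + _).
rewrite (linear_fun_sum S_linear) big_ord_recl big_ord_recr/=.
rewrite (gN c : diff _ _ = _) rmorph0 scale0r addr0.
rewrite (linear_funZ S_linear) S_y0 scaler0 add0r; apply: eq_bigr => i _.
by rewrite (linear_funZ S_linear) S_yS.
Qed.

Lemma iter_T_newton n N g c : diff_degree g N ->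
  iter n T (newton N g c) = newton N g (c + n%:R).
Proof.
move=> gN; elim: n => [|n IH]; first by rewrite addr0.
by rewrite iterS IH T_newton// -addrA natr1.
Qed.

(** Used with $s = \pm 1/M$ and $L = N-k$: the degree is then at most $N$, so the expansion [newton]
    stopped at $N$ loses nothing. *)
Definition profile k L (s x : R) : R := gbinom k x * (1 + s * x) ^+ L.

Lemma profile_degree k N s : (k <= N)%N -> diff_degree (profile k (N - k) s) N.
Proof.
move=> kN; have := diff_degreeM (@diff_degree_gbinom R k)
  (diff_degreeX (N - k) (diff_degree_affine s)).
by rewrite subnKC.
Qed.

Lemma nm_newton_le N g c :
  nm (newton N g c) <= \sum_(m < N.+1) `|iter m (@diff R) g c| * nm (y m).
Proof.
rewrite (le_trans (nm_sum _ _ _))// ler_sum// => i _.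
by rewrite nmZ av_iota.
Qed.

(** As $y_k$ is the Newton vector of $\binom{x}{k}$, the difference is that of
    $\binom{x}{k}((1+sx)^L - 1)$. Write $Q = N+1$ and $q = 1/Q$. The second factor has amplitude
    $q^2$ and gains $q^4$ per difference; against $2^m$ and the growth $Q^{3j}$ this leaves $(2q)^j
    \le 1$. Each term is thus at most $2^k b_k q^2$, and there are $Q$ of them. *)
Lemma newton_profile_near k N s : slow_growth N -> (0 < N)%N -> (k <= N)%N ->
  `|s| = (N.+1%:R ^+ 8)^-1 ->
  nm (newton N (profile k (N - k) s) 0 - y k) <= 2 ^+ k * b k / N.+1%:R.
Proof.
move=> Ngood N0 kN sE; set L := (N - k)%N; set Q : R := N.+1%:R.
pose q : R := Q^-1.
have Q0 : 0 < Q by rewrite ltr0n.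
have qQ : q * Q = 1 by rewrite mulVf// gt_eqF.
have q0 : 0 < q by rewrite invr_gt0.
have q2 : q <= 2^-1 by rewrite lef_pV2 ?posrE// ler_nat.
have {}sE : `|s| = q ^+ 8 by rewrite sE exprVn.
have LQ : L%:R <= Q by rewrite ler_nat (leq_trans (leq_subr _ _)).
have Lq : L%:R * q <= 1 by rewrite mulrC -[leRHS]qQ ler_wpM2l// ltW.
have iq i : (i <= N)%N -> i%:R * q <= 1.
  by move=> iN; rewrite mulrC -[leRHS]qQ ler_wpM2l ?(ltW q0)// ler_nat leqW.
have L0 : 0 <= L%:R :> R by [].
have nsi i : (i <= N)%N -> `|s * i%:R| <= q ^+ 7.
  move=> /iq iN; rewrite normrM sE (ger0_norm (ler0n _ _)) exprSr -mulrA ler_piMr ?exprn_ge0 ?(ltW q0)//.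
  by rewrite mulrC.
have q71 : 2 * L%:R * q ^+ 7 <= q ^+ 2.
  have : L%:R * q ^+ 7 <= q ^+ 6 by rewrite exprS mulrA ler_piMl ?exprn_ge0 ?(ltW q0).
  have q3 : q ^+ 3 <= 2^-1 ^+ 3 by rewrite lerXn2r ?nnegrE ?(ltW q0)//.
  have : q ^+ 6 <= q ^+ 3 * 2^-1 ^+ 3 by rewrite -[6%N]/(3 + 3)%N exprD ler_wpM2l// exprn_ge0// ltW.
  have : q ^+ 3 <= q ^+ 2 * 1 by rewrite exprSr ler_wpM2l ?exprn_ge0 ?(ltW q0)//; lra.
  have : 0 <= q ^+ 3 by rewrite exprn_ge0// ltW.
  by rewrite !exprS expr0; nra.
have q21 : q ^+ 2 <= 1 by rewrite exprn_ile1 ?(ltW q0)//; lra.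
pose h x := (1 + s * x) ^+ L; pose h' x := h x + - 1.
have hb : diff_bounded h 2 (q ^+ 7) 0 N.
  pose A : R := 1 + q ^+ 7.
  have A1 : 1 <= A by rewrite lerDl exprn_ge0// ltW.
  have A0 : 0 < A by rewrite (lt_le_trans _ A1).
  have aff : diff_bounded (fun x => 1 + s * x) A (`|s| / A) 0 N.
    apply: diff_bounded_affine => // i iN; rewrite add0r.
    by rewrite (le_trans (ler_normD _ _))// normr1 lerD2l nsi.
  have := diff_boundedX L (ltW A0) (divr_ge0 (normr_ge0 s) (ltW A0)) aff.
  move=> hA m i mi; apply: le_trans (hA m i mi) _.
  have AL : A ^+ L <= 2.
    have /norm_expr1D_sub1 : 2 * L%:R * `|q ^+ 7| <= 1.
      by rewrite ger0_norm ?exprn_ge0 ?(ltW q0)// (le_trans q71).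
    rewrite (ger0_norm (exprn_ge0 _ (ltW q0))) => AL1.
    by have := le_trans (ler_norm _) AL1; rewrite -/A; move: q71 q21; lra.
  apply: ler_pM; rewrite ?exprn_ge0 ?(ltW A0) ?mulr_ge0 ?invr_ge0 ?(ltW A0)//.
  rewrite lerXn2r ?nnegrE ?mulr_ge0 ?invr_ge0 ?exprn_ge0 ?(ltW A0) ?(ltW q0)//.
  rewrite mulrA ler_pdivrMr// sE exprS mulrA.
  rewrite (le_trans (ler_wpM2r _ Lq)) ?exprn_ge0 ?(ltW q0)// mul1r.
  by rewrite ler_peMr ?exprn_ge0 ?(ltW q0).
(* Origin of the exponent 8: with $|s| = q^8$ and $L \le Q$ one difference of $h$ gains $q^7$, which
   pays for the amplitude $q^2$, for the gain $q^4$, and with the remaining $q \le 1/2$ for the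
   constant 2. *)
have h'b : diff_bounded h' (q ^+ 2) (q ^+ 4) 0 N.
  move=> [|m] i mi.
    rewrite /= expr0 mulr1 add0r /h' /h.
    have si := nsi i mi; have Ls : 2 * L%:R * `|s * i%:R| <= q ^+ 2.
      by rewrite (le_trans _ q71)// ler_wpM2l// mulr_ge0.
    by rewrite (le_trans (norm_expr1D_sub1 _)) ?(le_trans Ls).
  rewrite /h' diffD diff_cst addr0 (le_trans (hb m.+1 i mi))//.
  rewrite -!exprM -exprD -[(7 * _)%N]/((4 + 3) * m.+1)%N mulnDl.
  rewrite (_ : (4 * m.+1 + 3 * m.+1 = (3 * m) + 1 + (2 + 4 * m.+1))%N); last by lia.
  rewrite exprD mulrA ler_piMl ?exprn_ge0 ?(ltW q0)//.
  rewrite addn1 exprS mulrCA mulrA.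
  have : q ^+ (3 * m) <= 1 by rewrite exprn_ile1 ?(ltW q0)//; lra.
  have : 0 <= q ^+ (3 * m) by rewrite exprn_ge0// ltW.
  by nra.
have eqy : y k = newton N (gbinom k) 0.
  rewrite /newton (bigD1 (inord k))//= inordK ?ltnS// big1 => [|i ik].
    by rewrite iter_diff_gbinom// subnn /= rmorph1 scale1r addr0.
  have {}ik : (i : nat) != k by apply: contraNneq ik => <-; rewrite inord_val.
  have [ik'|ki] := leqP i k.
    rewrite iter_diff_gbinom// gbinom0 subn_eq0 leqNgt ltn_neqAle ik ik'/=.
    by rewrite rmorph0 scale0r.
  rewrite -(subnK ki) iterD (_ : iter k.+1 _ _ = (fun=> 0)); last first.
    by apply/funext => x; exact: diff_degree_gbinom.
  by case: (i - k.+1)%N => [|n]; rewrite ?diff_cst /= rmorph0 scale0r.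
have -> : newton N (profile k L s) 0 - y k = newton N (fun x => gbinom k x * h' x) 0.
  rewrite eqy /newton -sumrB; apply: eq_bigr => m _; rewrite -scalerBl -rmorphB.
  have -> : profile k L s = (fun x => gbinom k x + gbinom k x * h' x).
    by apply/funext => x; rewrite /profile /h' /h; ring.
  by rewrite diffD addrAC subrr add0r.
rewrite (le_trans (nm_newton_le _ _ _))//.
have term (m : 'I_N.+1) : `|iter m (@diff R) (fun x => gbinom k x * h' x) 0| * nm (y m) <=
    2 ^+ k * b k * q ^+ 2.
  have := diff_gbinomM_0 k (exprn_ge0 2 (ltW q0)) (exprn_ge0 4 (ltW q0)) h'b
    (ltn_ord m : (m <= N)%N).
  have [mk|km] := ltnP m k.
    move=> h0; rewrite (_ : `|_| = 0); last by apply/eqP; rewrite eq_le h0 normr_ge0.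
    by rewrite mul0r !mulr_ge0 ?exprn_ge0 ?(ltW q0).
  have mE : (m : nat) = (k + (m - k))%N by rewrite subnKC.
  have := Ngood k (m - k)%N; rewrite -mE => /(_ (ltn_ord m : (m <= N)%N)).
  set j := (m - k)%N in mE * => ym dm.
  rewrite (le_trans (ler_pM _ _ dm ym)) ?nm_ge0//.
  rewrite mE exprD -/Q.
  have -> : 2 ^+ k * 2 ^+ j * q ^+ 2 * (q ^+ 4) ^+ j * (b k * Q ^+ (3 * j)) =
    2 ^+ k * b k * q ^+ 2 * (2 * q * (q * Q) ^+ 3) ^+ j.
    have -> : 2 * q * (q * Q) ^+ 3 = 2 * q ^+ 4 * Q ^+ 3 by ring.
    rewrite [(_ * Q ^+ 3) ^+ j]exprMn [(2 * _) ^+ j]exprMn exprM.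
    by move: (2 ^+ k) (2 ^+ j) ((q ^+ 4) ^+ j) ((Q ^+ 3) ^+ j) => z1 z2 z3 z4; ring.
  rewrite qQ expr1n mulr1 ler_piMr ?mulr_ge0 ?exprn_ge0 ?(ltW q0)//.
  by rewrite exprn_ile1 ?mulr_ge0 ?(ltW q0)//; lra.
rewrite (le_trans (ler_sum _ (fun m _ => term m)))// sumr_const card_ord.
rewrite -[leLHS]mulr_natr -/Q -/q expr2 -!mulrA qQ mulr1//.
Qed.

(** The binomial factor contributes amplitude $(3Q^8)^k$ and rate $1/(3Q^8)$, the power contributes
    $\rho^L$ and $L|s|/\rho$. As $\rho \ge 1/2$, the total rate is at most $3Q/Q^8$ and beats the
    growth $Q^3$, so every term is bounded by the product of the amplitudes and $b_0$. *)
Lemma newton_profile_small k N s c (rho : R) : slow_growth N -> (0 < N)%N -> (k <= N)%N ->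
  `|s| = (N.+1%:R ^+ 8)^-1 -> 2^-1 <= rho <= 1 ->
  (forall i, (i <= N)%N -> `|c + i%:R| + k%:R <= 3 * N.+1%:R ^+ 8) ->
  (forall i, (i <= N)%N -> `|1 + s * (c + i%:R)| <= rho) ->
  nm (newton N (profile k (N - k) s) c) <=
    b 0 * (3 * N.+1%:R ^+ 8) ^+ k * rho ^+ (N - k) * N.+1%:R.
Proof.
move=> Ngood N0 kN sE /andP[rho2 rho1] cM crho; set L := (N - k)%N; set Q : R := N.+1%:R.
have rho0 : 0 < rho by lra.
have Q2 : 2 <= Q by rewrite ler_nat.
have Q0 : 0 < Q by lra.
have gb := diff_bounded_gbinom (mulr_gt0 (ltr0n _ 3) (exprn_gt0 8 Q0)) cM.
have hb := diff_boundedX L (ltW rho0) (divr_ge0 (normr_ge0 s) (ltW rho0))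
  (diff_bounded_affine rho0 crho).
have M0 : 0 <= 3 * Q ^+ 8 by rewrite mulr_ge0 ?exprn_ge0 ?(ltW Q0).
have r0 : 0 <= L%:R * (`|s| / rho) by rewrite !mulr_ge0 ?invr_ge0 ?(ltW rho0).
have := diff_boundedM (exprn_ge0 k M0) (exprn_ge0 L (ltW rho0)) _ r0 gb hb.
rewrite invr_ge0 => /(_ M0); set r := _ + _ => pb.
have r_ge0 : 0 <= r by rewrite addr_ge0 ?invr_ge0.
have rQ : r * Q ^+ 3 <= 1.
  have Q8 : 0 < Q ^+ 8 by rewrite exprn_gt0.
  have LQ : L%:R <= Q by rewrite ler_nat (leq_trans (leq_subr _ _)).
  have rle : r <= (3 * Q) / Q ^+ 8.
    rewrite /r sE -/Q invfM.
    have -> : 3^-1 / Q ^+ 8 + L%:R * ((Q ^+ 8)^-1 / rho) = (3^-1 + L%:R / rho) / Q ^+ 8 by field; rewrite !gt_eqF.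
    rewrite ler_pM2r ?invr_gt0//.
    have : L%:R / rho <= 2 * Q.
      by rewrite ler_pdivrMr//; nra.
    by lra.
  rewrite (le_trans (ler_wpM2r _ rle)) ?exprn_ge0 ?(ltW Q0)//.
  rewrite mulrAC ler_pdivrMr// mul1r.
  have -> : 3 * Q * Q ^+ 3 = 3 * Q ^+ 4 by ring.
  have -> : Q ^+ 8 = Q ^+ 4 * Q ^+ 4 by rewrite -exprD.
  rewrite ler_wpM2r ?exprn_ge0 ?(ltW Q0)//.
  have : 2 ^+ 4 <= Q ^+ 4 by rewrite lerXn2r ?nnegrE ?(ltW Q0).
  by rewrite -natrX; lra.
rewrite (le_trans (nm_newton_le _ _ _))//.
have term (m : 'I_N.+1) : `|iter m (@diff R) (profile k L s) c| * nm (y m) <=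
    b 0 * (3 * Q ^+ 8) ^+ k * rho ^+ L.
  have := pb m 0%N; rewrite !addr0 addn0 => /(_ (ltn_ord m : (m <= N)%N)) dm.
  have ym := Ngood 0%N m (ltn_ord m : (m <= N)%N).
  rewrite (le_trans (ler_pM _ _ dm ym)) ?nm_ge0//.
  rewrite -/Q exprM.
  have -> : (3 * Q ^+ 8) ^+ k * rho ^+ L * r ^+ m * (b 0 * (Q ^+ 3) ^+ m) =
     b 0 * (3 * Q ^+ 8) ^+ k * rho ^+ L * (r * Q ^+ 3) ^+ m.
    rewrite [(r * _) ^+ m]exprMn.
    by move: (r ^+ m) ((Q ^+ 3) ^+ m) ((3 * Q ^+ 8) ^+ k) (rho ^+ L) => z1 z2 z3 z4; ring.
  rewrite ler_piMr ?mulr_ge0 ?exprn_ge0 ?(ltW rho0) ?(ltW Q0)//.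
  by rewrite exprn_ile1// mulr_ge0 ?exprn_ge0 ?(ltW Q0).
rewrite (le_trans (ler_sum _ (fun m _ => term m)))// sumr_const card_ord.
by rewrite -[leLHS]mulr_natr.
Qed.

(* The first vector has a small orbit on a long interval; the second one is a
   small vector sent close to t, which yields transitivity. *)
Definition reachable (t : X) := forall (rho e : R), 2^-1 <= rho < 1 -> 0 < e ->
  exists J, forall N, (J <= N)%N -> slow_growth N ->
  (exists v, nm (v - t) < e /\ forall n, (n <= N.+1 ^ 8)%N ->
     (forall i, (i <= N)%N -> `|1 - (n + i)%:R / (N.+1 ^ 8)%:R| <= rho) ->
     nm (iter n T v) < e) /\
  (exists u, nm u < e /\ nm (iter (N.+1 ^ 8) T u - t) < e).

Lemma reachable_y k : reachable (y k).
Proof.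
move=> rho e /andP[rho2 rho1] e0.
have rho0 : 0 < rho by lra.
(* The exponent $8k+2$: $8k$ from $(3Q^8)^k$, one for the number of terms, and one more to leave a
   factor $1/Q$ that tends to 0. *)
have [C CP] : exists C : R, forall n, n.+1%:R ^+ (8 * k).+2 * rho ^+ n <= C.
  by apply: poly_geometric_bounded; rewrite rho1 ltW.
pose E := `|2 ^+ k * b k| + `|b 0 * 3 ^+ k * rho ^- k * C|.
exists (maxn (k + 1) (Num.truncn (E / e))) => N; rewrite geq_max addn1 => /andP[kN EN] Ngood.
have N0 : (0 < N)%N by rewrite (leq_ltn_trans _ kN).
have {}kN := ltnW kN.
pose Q : R := N.+1%:R; have Q0 : 0 < Q by rewrite ltr0n.
have EQ : E / Q < e.
  rewrite ltr_pdivrMr// mulrC -ltr_pdivrMr// (lt_le_trans (truncnS_gt _))//.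
  by rewrite ler_nat ltnS.
pose M := (N.+1 ^ 8)%N; have ME : M%:R = Q ^+ 8 :> R by rewrite /M natrX.
have M0 : 0 < M%:R :> R by rewrite ME exprn_gt0.
have NM : (2 * N <= M)%N.
  rewrite /M expnS (leq_trans (n := N.+1 * 2))//; first by rewrite mulnC leq_mul2r leqnSn orbT.
  by rewrite leq_mul2l/= (leq_trans (n := 2 ^ 7))// leq_exp2r// ltnS.
have NM' : 2 * N%:R <= M%:R :> R by rewrite -natrM ler_nat.
have iN_M i : (i <= N)%N -> i%:R / M%:R <= 2^-1 :> R.
  move=> iN; rewrite ler_pdivrMr//; have : i%:R <= N%:R :> R by rewrite ler_nat.
  by lra.
have near s : `|s| = (Q ^+ 8)^-1 -> nm (newton N (profile k (N - k) s) 0 - y k) < e.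
  move=> sE; rewrite (le_lt_trans (newton_profile_near Ngood N0 kN sE))//.
  rewrite (le_lt_trans _ EQ)// ler_pM2r ?invr_gt0// (le_trans (ler_norm _))//.
  by rewrite lerDl.
have small s c : `|s| = (Q ^+ 8)^-1 ->
    (forall i, (i <= N)%N -> `|c + i%:R| + k%:R <= 3 * Q ^+ 8) ->
    (forall i, (i <= N)%N -> `|1 + s * (c + i%:R)| <= rho) ->
    nm (newton N (profile k (N - k) s) c) < e.
  move=> sE cM crho; have r12 : 2^-1 <= rho <= 1 by rewrite rho2 ltW.
  rewrite (le_lt_trans (newton_profile_small Ngood N0 kN sE r12 cM crho))//.
  rewrite (le_lt_trans _ EQ)// ler_pdivlMr//.
  have := CP N; rewrite -/Q => CN.
  have -> : b 0 * (3 * Q ^+ 8) ^+ k * rho ^+ (N - k) * N.+1%:R * Q =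
      (b 0 * 3 ^+ k * rho ^- k) * (Q ^+ (8 * k).+2 * rho ^+ N).
    rewrite exprMn -exprM -/Q exprB// ?unitfE ?gt_eqF// !exprS.
    by move: (Q ^+ _) (rho ^+ N) (rho ^- k) (3 ^+ k) => z1 z2 z3 z4; ring.
  rewrite (le_trans (ler_wpM2l _ CN)) ?mulr_ge0 ?invr_ge0 ?exprn_ge0 ?(ltW rho0)//.
  by rewrite (le_trans (ler_norm _))// lerDr.
have deg s := profile_degree s kN.
have k_M : k%:R <= M%:R :> R by rewrite ler_nat (leq_trans kN)// (leq_trans _ NM)// leq_pmull.
have i_M i : (i <= N)%N -> i%:R <= M%:R :> R.
  by move=> iN; rewrite ler_nat (leq_trans iN)// (leq_trans _ NM)// leq_pmull.
split.
- exists (newton N (profile k (N - k) (- M%:R^-1)) 0); split.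
    by apply: near; rewrite normrN ger0_norm ?invr_ge0 ?(ltW M0)// ME.
  move=> n nM hn; rewrite iter_T_newton// add0r; apply: small.
  + by rewrite normrN ger0_norm ?invr_ge0 ?(ltW M0)// ME.
  + move=> i iN; rewrite -ME -natrD ger0_norm// natrD.
    have : n%:R <= M%:R :> R by rewrite ler_nat.
    by have := i_M i iN; lra.
  + by move=> i iN; rewrite mulNr mulrC -natrD; exact: hn.
(* Start the profile with slope $+1/M$ at $-M$, where $1 + x/M$ is at most $1/2$ on the window;
   after $M$ translations it is read at 0, where it is close to $y_k$. *)
- exists (newton N (profile k (N - k) M%:R^-1) (- M%:R)); split.
    apply: small.
    + by rewrite ger0_norm ?invr_ge0 ?(ltW M0)// ME.
    + move=> i iN; rewrite -ME ler0_norm; last by have := i_M i iN; lra.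
      by have : 0 <= i%:R :> R by []; lra.
    + move=> i iN; rewrite mulrDr mulrN mulVf ?gt_eqF// addrA subrr add0r.
      rewrite mulrC ger0_norm ?mulr_ge0 ?invr_ge0 ?(ltW M0)//.
      exact: le_trans (iN_M i iN) rho2.
  rewrite iter_T_newton// addNr; apply: near.
  by rewrite ger0_norm ?invr_ge0 ?(ltW M0)// ME.
Qed.

Lemma reachable0 : reachable 0.
Proof.
move=> rho e _ e0; exists 0%N => N _ _.
have T0 n : iter n T 0 = 0.
  by elim: n => [//|n IH]; rewrite iterS IH (linear_fun0 T_linear).
split; exists 0; rewrite ?subrr ?nm0//; last by rewrite T0 subrr nm0.
by split => // n _ _; rewrite T0 nm0.
Qed.

(** The time $M = (N+1)^8$ depends on $N$ alone, so one common $N$ serves $t$ and $t'$, and the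
    approximating vectors combine linearly. *)
Lemma reachable_comb a t t' : reachable t -> reachable t' -> reachable (a *: t + t').
Proof.
move=> rt rt' rho e hrho e0.
pose d := e / (av a + 2); have a2 : 0 < av a + 2 by rewrite (lt_le_trans (ltr0Sn _ 1))// lerDr.
have d0 : 0 < d by rewrite divr_gt0.
have lt_e (u u' : X) : nm u < d -> nm u' < d -> nm (a *: u + u') < e.
  move=> ud u'd; rewrite (le_lt_trans (nmD _ _))// nmZ.
  have -> : e = av a * d + 2 * d by rewrite -mulrDl mulrC divfK// gt_eqF.
  by rewrite ler_ltD ?ler_wpM2l ?(ltW ud)// (lt_trans u'd)// mulrC ltr_pMr// ltr1n.
have subE (u u' : X) : a *: u + u' - (a *: t + t') = a *: (u - t) + (u' - t').
  by rewrite opprD addrACA scalerBr.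
have [J HJ] := rt rho d hrho d0; have [J' HJ'] := rt' rho d hrho d0.
exists (maxn J J') => N; rewrite geq_max => /andP[JN J'N] Ngood.
have [[v [vt vs]] [u [ud ut]]] := HJ N JN Ngood.
have [[v' [vt' vs']] [u' [ud' ut']]] := HJ' N J'N Ngood.
split.
- exists (a *: v + v'); rewrite subE; split; first exact: lt_e.
  move=> n nM hn; rewrite (iter_linear T_linear).
  by apply: lt_e; [exact: vs|exact: vs'].
- exists (a *: u + u'); split; first exact: lt_e.
  by rewrite (iter_linear T_linear) subE; exact: lt_e.
Qed.

Lemma reachable_span n t : in_span n y t -> reachable t.
Proof.
move=> [a ->]; elim: n => [|n IH]; first by rewrite big_ord0; exact: reachable0.
by rewrite big_ord_recr/= addrC; apply: reachable_comb => //; exact: reachable_y.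
Qed.

Let nm_close (u v w : X) (e : R) : nm (u - v) < e / 2 -> nm (v - w) < e / 2 -> nm (u - w) < e.
Proof. by move=> uv vw; rewrite (le_lt_trans (nm_sub _ _ v))//; lra. Qed.

Lemma killing_orbit (v0 : X) (e : R) j : 0 < e ->
  exists v M, [/\ nm (v - v0) < e, (j < M)%N & forall n, (M <= j.+1 * n)%N ->
    (n <= M)%N -> nm (iter n T v) < e].
Proof.
move=> e0; have e20 : 0 < e / 2 by rewrite divr_gt0.
have [m [t [/reachable_span rt v0t]]] := y_dense v0 e20.
(* On the window $(n+i)/M$ lies between $1/(j+1)$ and $3/2$, so $\rho = 1 - 1/(j+2)$ works; taking
   $j+2$ keeps $\rho \ge 1/2$ even for $j = 0$. *)
have [z zE] : exists z : R, z = j.+2%:R^-1 by exists j.+2%:R^-1.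
pose rho : R := 1 - z.
have j2 : z <= 2^-1 by rewrite zE lef_pV2 ?posrE// ler_nat.
have j20 : 0 < z by rewrite zE invr_gt0.
have hrho : 2^-1 <= rho < 1 by rewrite /rho; apply/andP; split; lra.
have [J HJ] := rt _ _ hrho e20.
have [N + Ngood] := slow_growth_often (maxn J j.+1); rewrite geq_max => /andP[JN jN].
have [[v [vt vs]] _] := HJ N JN Ngood.
pose M := (N.+1 ^ 8)%N.
have NM : (2 * N <= M)%N.
  rewrite /M expnS (leq_trans (n := N.+1 * 2))//; first by rewrite mulnC leq_mul2r leqnSn orbT.
  by rewrite leq_mul2l/= (leq_trans (n := 2 ^ 7))// leq_exp2r// ltnS (leq_trans _ jN).
exists v, M; split.
- by apply: nm_close vt _; rewrite nm_subC.
- by rewrite (leq_trans jN)// (leq_trans _ NM)// leq_pmull.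
- move=> n Mn nM; rewrite (lt_trans (vs n nM _))//; last by lra.
  move=> i iN; have M0 : 0 < M%:R :> R by rewrite ltr0n expn_gt0.
  have nM' : n%:R <= M%:R :> R by rewrite ler_nat.
  have iM : 2 * i%:R <= M%:R :> R by rewrite -natrM ler_nat (leq_trans _ NM)// leq_mul2l.
  have Mn' : M%:R * z <= n%:R.
    rewrite zE ler_pdivrMr// -natrM ler_nat (leq_trans Mn)// mulnC leq_mul2l leqnSn orbT//.
  have h : (n + i)%:R / M%:R <= 3 * 2^-1 :> R.
    by rewrite ler_pdivrMr// natrD; lra.
  have h' : z <= (n + i)%:R / M%:R.
    by rewrite ler_pdivlMr// mulrC natrD; have : 0 <= i%:R :> R by []; lra.
  move: h h'; rewrite -/M; move: (_ / _) => w h h'.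
  by rewrite ler_norml /rho; apply/andP; split; lra.
Qed.

(** Add a vector near $v_0$ that is small at time $M$ to a small vector that is near $w_0$ at time
    $M$. At $n = M$ the condition reads $i/M \le \rho$, so $\rho = 1/2$ is enough. *)
Lemma orbit_transitive (v0 w0 : X) (e : R) : 0 < e ->
  exists v n, nm (v - v0) < e /\ nm (iter n T v - w0) < e.
Proof.
move=> e0; have e40 : 0 < e / 2 / 2 by rewrite !divr_gt0.
have [m [t [/reachable_span rt v0t]]] := y_dense v0 e40.
have [m' [t' [/reachable_span rt' w0t']]] := y_dense w0 e40.
have [rho [hrho rhoE]] : exists rho : R, 2^-1 <= rho < 1 /\ rho = 2^-1.
  by exists 2^-1; split => //; apply/andP; split; lra.
have [J HJ] := rt _ _ hrho e40; have [J' HJ'] := rt' _ _ hrho e40.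
have [N + Ngood] := slow_growth_often (maxn (maxn J J') 1).
rewrite !geq_max -andbA => /and3P[JN J'N N0].
have [[v [vt vs]] _] := HJ N JN Ngood; have [_ [u [ue ut]]] := HJ' N J'N Ngood.
pose M := (N.+1 ^ 8)%N.
have NM : (2 * N <= M)%N.
  rewrite /M expnS (leq_trans (n := N.+1 * 2))//; first by rewrite mulnC leq_mul2r leqnSn orbT.
  by rewrite leq_mul2l/= (leq_trans (n := 2 ^ 7))// leq_exp2r// ltnS.
have Tv : nm (iter M T v) < e / 2 / 2.
  apply: vs => // i iN; have M0 : 0 < M%:R :> R by rewrite ltr0n expn_gt0.
  rewrite natrD mulrDl mulfV ?gt_eqF// opprD addrA subrr sub0r normrN.
  rewrite ger0_norm ?divr_ge0// rhoE ler_pdivrMr// -/M.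
  have : 2 * i%:R <= M%:R :> R by rewrite -natrM ler_nat (leq_trans _ NM)// leq_mul2l.
  by lra.
exists (1 *: v + u), M; split.
  rewrite scale1r; apply: (@nm_close _ t); last by rewrite nm_subC (lt_trans v0t)//; lra.
  by rewrite addrAC (le_lt_trans (nmD _ _))//; lra.
rewrite (iter_linear T_linear) scale1r; apply: (@nm_close _ t'); last first.
  by rewrite nm_subC (lt_trans w0t')//; lra.
by rewrite -addrA (le_lt_trans (nmD _ _))//; lra.
Qed.

Lemma f0_iter_T_y n k : f0 (iter n T (y k)) = ('C(n, k))%:R.
Proof.
elim: n k => [|n IH] k; first by rewrite /= f0_y bin0n.
rewrite iterSr {2}/T; case: k => [|k]; first by rewrite S_y0 addr0 IH !bin0.
have := iter_linear T_linear n 1 (y k.+1) (y k); rewrite !scale1r S_yS => ->.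
by rewrite (functionalD f0_functional) !IH binS natrD.
Qed.

Lemma iter_S_y r k : iter r S (y k) = if (r <= k)%N then y (k - r) else 0.
Proof.
elim: r k => [|r IH] k; first by rewrite subn0.
rewrite iterSr; case: k => [|k]; last by rewrite S_yS IH ltnS subSS.
by rewrite S_y0 ltn0; elim: r {IH} => [//|r IH]; rewrite iterS IH (linear_fun0 S_linear).
Qed.

(** Consecutive binomial coefficients have ratio $(n-i)/(i+1)$, which is at least $L$ for $i < D$
    once $n \ge D + LD$. *)
Lemma bin_growth (n L a c D : nat) : (0 < L)%N -> (D + L * D <= n)%N ->
  (a < c)%N -> (c <= D)%N -> (L * 'C(n, a) <= 'C(n, c))%N.
Proof.
move=> L0 Dn ac cD.
have step i : (i < D)%N -> (L * 'C(n, i) <= 'C(n, i.+1))%N.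
  move=> iD; rewrite -(leq_pmul2l (ltn0Sn i)) mul_bin_left mulnCA mulnA.
  rewrite leq_mul2r; apply/orP; right.
  rewrite leq_subRL; last by rewrite (leq_trans _ Dn)// (leq_trans (ltnW iD))// leq_addr.
  by rewrite (leq_trans _ Dn)// leq_add ?(ltnW iD)// leq_mul2l iD orbT.
rewrite -(subnKC ac) in cD *; elim: (c - a.+1)%N cD => [|d IH] cD.
  by rewrite addn0 in cD *; exact: step.
rewrite addnS in cD *; rewrite (leq_trans (IH (ltnW cD)))// (leq_trans _ (step _ cD))//.
by rewrite leq_pmull.
Qed.

(* Adding a small multiple of y D with D large makes the orbit of S^r v grow
   like n^(D - r), which dominates the contributions of S^i v for i > r. *)
Lemma escaping_orbit (v0 : X) (e : R) j : 0 < e ->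
  exists v M, [/\ nm (v - v0) < e, (j < M)%N & forall n, (M <= j.+1 * n)%N ->
    (n <= M)%N -> forall r, (r <= j)%N ->
    j.+1%:R + j%:R * \sum_(r.+1 <= i < j.+1) av (f0 (iter n T (iter i S v))) <
      av (f0 (iter n T (iter r S v)))].
Proof.
move=> e0; have e20 : 0 < e / 2 by rewrite divr_gt0.
have [D0 [t [[a tE] v0t]]] := y_dense v0 e20.
(* $D$ exceeds every index occurring in $t$ and every $r \le j$, so $y_{D-r}$ is the leading term of
   $S^r v$. *)
pose D := (maxn D0 j).+1.
pose d : R := e / 2 / (nm (y D) + 1).
have yD0 : 0 < nm (y D) + 1 by rewrite ltr_pwDr.
have d0 : 0 < d by rewrite divr_gt0.
have dy : d * nm (y D) < e / 2.
  by rewrite /d mulrAC ltr_pdivrMr// ltr_pM2l// ltrDl.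
pose A := \sum_(m < D0) av (a m); have A0 : 0 <= A by exact: sumr_ge0.
(* The three summands pay for the part of $S^r v$ coming from $t$, for $j$ times the at most $j$
   later terms, and for the additive constant $j+1$. *)
pose B : R := A + j%:R * (j%:R * (d + A)) + j.+1%:R.
have B0 : 0 <= B by rewrite !addr_ge0 ?mulr_ge0 ?addr_ge0// ltW.
pose L := (Num.truncn (2 * B / d)).+1.
have LB : 2 * B < L%:R * d by rewrite -ltr_pdivrMr// truncnS_gt.
pose v := iota d *: y D + t.
have fE n r : (r <= j)%N -> f0 (iter n T (iter r S v)) =
    iota d * ('C(n, D - r))%:R + f0 (iter n T (iter r S t)).
  move=> rj; rewrite (iter_linear S_linear) (iter_linear T_linear) f0_functional.1.
  by rewrite iter_S_y (leq_trans rj) ?f0_iter_T_y// leqW// leq_maxr.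
have ft n r c : (r <= j)%N -> (forall m, (r <= m < D0)%N -> (L * 'C(n, m - r) <= c)%N) ->
    L%:R * av (f0 (iter n T (iter r S t))) <= A * c%:R.
  move=> rj hc.
  have lin a' w z : f0 (iter n T (iter r S (a' *: w + z))) =
      a' * f0 (iter n T (iter r S w)) + f0 (iter n T (iter r S z)).
    by rewrite (iter_linear S_linear) (iter_linear T_linear) f0_functional.1.
  have sumE : f0 (iter n T (iter r S t)) =
      \sum_(m < D0) a m * f0 (iter n T (iter r S (y m))).
    rewrite tE; elim: (D0) => [|p IH].
      rewrite !big_ord0; have := lin 1 0 0; rewrite scaler0 addr0 mul1r => /eqP.
      by rewrite -subr_eq subrr => /eqP <-.
    by rewrite !big_ord_recr/= addrC lin IH addrC.
  rewrite sumE (le_trans (ler_wpM2l _ (av_sum _ _ _)))// mulr_sumr mulr_suml.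
  apply: ler_sum => m _; rewrite avM mulrCA ler_wpM2l//.
  rewrite iter_S_y; case: (leqP r m) => rm.
    rewrite f0_iter_T_y -(rmorph_nat iota) av_iota ger0_norm// -natrM ler_nat.
    by apply: hc; rewrite rm/=.
  have T0 : iter n T 0 = 0.
    by elim: n {hc lin sumE} => [//|n IH]; rewrite iterS IH (linear_fun0 T_linear).
  by rewrite T0 (functional0 f0_functional) av0 mulr0.
(* On the window this forces $n \ge D + LD$, the range of [bin_growth]; the last summand ensures $j
   < M$. *)
exists v, (j.+1 * (D + L * D) + j.+1)%N; split.
- rewrite /v; apply: (@nm_close _ t); last by rewrite nm_subC.
  by rewrite addrK nmZ av_iota gtr0_norm.
- by rewrite (leq_trans _ (leq_addl _ _)).
move=> n Mn _ r rj.
have {}Mn : (D + L * D <= n)%N.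
  by rewrite -(leq_pmul2l (ltn0Sn j)) (leq_trans _ Mn)// leq_addr.
have D0D : (D0 < D)%N by rewrite ltnS leq_maxl.
have jD : (j < D)%N by rewrite ltnS leq_maxr.
pose c := 'C(n, D - r).
have rD : (r < D)%N by rewrite (leq_ltn_trans rj).
have Lc k : (k < D - r)%N -> (L * 'C(n, k) <= c)%N.
  by move=> kD; apply: (bin_growth _ Mn) => //; exact: leq_subr.
have L0 : 0 < L%:R :> R by rewrite ltr0n.
have cL : L%:R <= c%:R :> R.
  by rewrite ler_nat -[L]muln1 -(bin0 n) Lc// subn_gt0.
have upper i : (r < i)%N -> (i <= j)%N ->
    L%:R * av (f0 (iter n T (iter i S v))) <= (d + A) * c%:R.
  move=> ri ij; rewrite fE// (le_trans (ler_wpM2l (ltW L0) (avD _ _)))// mulrDr mulrDl.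
  rewrite lerD//.
    rewrite avM -(rmorph_nat iota) !av_iota gtr0_norm// ger0_norm// mulrCA.
    rewrite ler_wpM2l ?(ltW d0)// -natrM ler_nat Lc//.
    by rewrite ltn_sub2l.
  apply: ft => // m /andP[im mD]; apply: Lc.
  rewrite ltn_subLR// (leq_trans mD)// (leq_trans (ltnW D0D))//.
  by rewrite addnBA ?(ltnW rD)// -addnBAC ?(ltnW ri)// leq_addl.
have lower : L%:R * (d * c%:R) - A * c%:R <= L%:R * av (f0 (iter n T (iter r S v))).
  rewrite fE// lerBlDr; have : L%:R * av (f0 (iter n T (iter r S t))) <= A * c%:R.
    apply: ft => // m /andP[rm mD]; apply: Lc.
    by rewrite ltn_sub2r// (ltn_trans mD).
  move=> /(lerD (lexx (L%:R * av (iota d * ('C(n, D - r))%:R + f0 (iter n T (iter r S t)))))).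
  apply: le_trans; rewrite -mulrDr ler_wpM2l ?(ltW L0)//.
  have -> : d * c%:R = av (iota d * ('C(n, D - r))%:R).
    by rewrite avM -(rmorph_nat iota) !av_iota gtr0_norm// ger0_norm.
  set z1 := iota d * _; set z2 := f0 _.
  by rewrite -{1}[z1](addrK z2) (le_trans (avD _ _))// avN.
rewrite -(ltr_pM2l L0) (lt_le_trans _ lower)//.
have sum_le : L%:R * \sum_(r.+1 <= i < j.+1) av (f0 (iter n T (iter i S v))) <=
    j%:R * ((d + A) * c%:R).
  apply: (@le_trans _ _ (\sum_(r.+1 <= i < j.+1) (d + A) * c%:R)).
    by rewrite mulr_sumr; apply: ler_sum_nat => i /andP[]; exact: upper.
  rewrite sumr_const_nat -[leLHS]mulr_natl ler_wpM2r ?mulr_ge0 ?addr_ge0 ?(ltW d0)//.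
  by rewrite ler_nat subSS leq_subr.
have c0' : 0 < c%:R :> R by rewrite (lt_le_trans L0).
rewrite mulrDr mulrCA.
have : j%:R * (L%:R * \sum_(r.+1 <= i < j.+1) av (f0 (iter n T (iter i S v)))) <=
   j%:R * (j%:R * ((d + A) * c%:R)) by rewrite ler_wpM2l.
have : 2 * B * c%:R < L%:R * d * c%:R by rewrite ltr_pM2r.
have : L%:R * j.+1%:R <= c%:R * j.+1%:R :> R by rewrite ler_wpM2r.
have : 0 <= j%:R * (j%:R * (d + A)) * c%:R by rewrite !mulr_ge0 ?addr_ge0 ?(ltW d0) ?(ltW c0').
have : 0 < j.+1%:R * c%:R :> R by rewrite mulr_gt0.
have : 0 <= A * c%:R by rewrite mulr_ge0 ?(ltW c0').
have : B * c%:R = A * c%:R + j%:R * (j%:R * (d + A)) * c%:R + j.+1%:R * c%:R by rewrite /B; ring.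
move: (\sum_(_ <= _ < _) _) => s0.
by lra.
Qed.

(** Says that the interior of $G$ is dense, in the form of closed balls that the nested ball
    argument consumes. *)
Definition generic (G : X -> Prop) := forall (v0 : X) (e : R), 0 < e ->
  exists (v : X) (r : R), [/\ nm (v - v0) < e, 0 < r & forall z, nm (z - v) <= r -> G z].

Lemma genericI (G H : X -> Prop) : generic G -> generic H ->
  generic (fun z => G z /\ H z).
Proof.
move=> gG gH v0 e e0; have e20 : 0 < e / 2 by rewrite divr_gt0.
have [v [r [vv0 r0 Gv]]] := gG v0 _ e20.
have [v' [r' [v'v r'0 Hv']]] : exists v' r',
    [/\ nm (v' - v) < Num.min (e / 2) (r / 2), 0 < r' & forall z, nm (z - v') <= r' -> H z].
  by apply: gH; rewrite lt_min e20 divr_gt0.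
move: v'v; rewrite lt_min => /andP[v'v v'r].
exists v', (Num.min r' (r / 2)); split.
- by rewrite (le_lt_trans (nm_sub _ _ v))//; lra.
- by rewrite lt_min r'0 divr_gt0.
- move=> z; rewrite le_min => /andP[zr' zr]; split; last exact: Hv'.
  by apply: Gv; rewrite (le_trans (nm_sub _ _ v'))//; lra.
Qed.

Lemma generic_forall_lt n (G : nat -> X -> Prop) : (forall k, generic (G k)) ->
  generic (fun z => forall k, (k < n)%N -> G k z).
Proof.
move=> gG; elim: n => [|n IH].
  move=> v0 e e0; exists v0, 1; split => //; by rewrite subrr nm0.
move=> v0 e e0; have [v [r [v1 v2 v3]]] := genericI IH (gG n) v0 e0.
exists v, r; split => // z /v3[zn Gn] k; rewrite ltnS leq_eqVlt => /predU1P[->//|].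
exact: zn.
Qed.

Lemma baire_generic (G : nat -> X -> Prop) : (forall j, generic (G j)) ->
  exists z, forall j, G j z.
Proof.
move=> gG.
pose P j (p p' : X * R) := 0 < p.2 ->
  [/\ 0 < p'.2, p'.2 <= j.+2%:R^-1, forall z, nm (z - p'.1) <= p'.2 -> nm (z - p.1) <= p.2 &
      forall z, nm (z - p'.1) <= p'.2 -> G j z].
have /choice[nxt nxtP] : forall q : nat * (X * R), exists p', P q.1 q.2 p'.
  move=> [j [v r]]; have [r0|r0] := leP r 0.
    by exists (0, 0) => /=; rewrite /P /= ltNge r0.
  have r20 : 0 < r / 2 by rewrite divr_gt0.
  have [v' [r' [v'v r'0 Gv']]] := gG j v _ r20.
  exists (v', Num.min (Num.min r' (r / 2)) j.+2%:R^-1) => _ /=; split.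
  + by rewrite !lt_min r'0 r20 invr_gt0 ltr0n.
  + by rewrite ge_min lexx orbT.
  + move=> z; rewrite !le_min => /andP[/andP[_ zr] _].
    by rewrite (le_trans (nm_sub _ _ v'))//; lra.
  + by move=> z; rewrite !le_min => /andP[/andP[zr _] _]; exact: Gv'.
pose fix a j := if j is j'.+1 then nxt (j', a j') else (0, 1 : R).
have a0 j : 0 < (a j).2.
  by elim: j => [|j IH]; [exact: ltr01|have [] := nxtP (j, a j) IH].
have aP j := nxtP (j, a j) (a0 j); rewrite /= in aP.
have a_le j : (a j).2 <= 1 / j.+1%:R.
  by rewrite mul1r; case: j => [|j]; [rewrite invr1 lexx|have [_ + _ _] := aP j].
have nest m n z : (m <= n)%N -> nm (z - (a n).1) <= (a n).2 -> nm (z - (a m).1) <= (a m).2.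
  move=> /subnKC <-; elim: (n - m)%N => [|d IH]; first by rewrite addn0.
  by rewrite addnS => h; apply: IH; have [_ _ + _] := aP (m + d)%N; apply.
have self n : nm ((a n).1 - (a n).1) <= (a n).2 by rewrite subrr nm0 ltW.
have [l ll] := @complete_limit (fun n => (a n).1) 1
  (fun m n mn => le_trans (nest m n _ mn (self n)) (a_le m)).
exists l => j; have [_ _ _] := aP j; apply.
(* The limit lies in the closed ball of stage $j+1$: all later centres do, and they approach it at
   rate $1/(m+1)$. *)
rewrite -subr_le0; apply: (@le0_of_le_divS _ 1) => m; rewrite lerBlDr.
have := nest j.+1 (maxn j.+1 m) _ (leq_maxl _ _) (self _) => h.
rewrite (le_trans (nm_sub _ _ (a (maxn j.+1 m)).1))//.
rewrite lerD// (le_trans (ll _))// !mul1r lef_pV2 ?posrE// ler_nat ltnS leq_maxr//.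
Qed.

Lemma iter_T_close n u v : nm (iter n T u - iter n T v) <= 2 ^+ n * nm (u - v).
Proof.
have := iter_linear T_linear n (-1) v u; rewrite !scaleN1r ![- _ + _]addrC => <-.
exact: iter_T_bound.
Qed.

Let Ngt0 n : 0 < 2 ^+ n :> R. Proof. by rewrite exprn_gt0. Qed.

(** The last property is a triangular domination, at the same times for all $r \le j$: the term of
    index $r$ outweighs $j$ times all later ones together. A linear combination of the $S^i z$ is
    thereby governed by its first nonzero coefficient. *)
Lemma exists_generic_vector (d : nat -> X) : exists z,
  [/\ forall k (e : R), 0 < e -> exists n, nm (iter n T z - d k) < e,
      forall j : nat, exists2 M, (j < M)%N & forall n, (M <= j.+1 * n)%N -> (n <= M)%N ->
        nm (iter n T z) < j.+1%:R^-1 &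
      forall j : nat, exists2 M, (j < M)%N & forall n, (M <= j.+1 * n)%N -> (n <= M)%N ->
        forall r, (r <= j)%N ->
        j%:R + j%:R * \sum_(r.+1 <= i < j.+1) av (f0 (iter n T (iter i S z))) <
          av (f0 (iter n T (iter r S z)))].
Proof.
pose G1 j k z := exists n, nm (iter n T z - d k) < j.+1%:R^-1.
pose G2 (j : nat) z := exists2 M, (j < M)%N & forall n, (M <= j.+1 * n)%N -> (n <= M)%N ->
  nm (iter n T z) < j.+1%:R^-1.
pose G3 (j : nat) z := exists2 M, (j < M)%N & forall n, (M <= j.+1 * n)%N -> (n <= M)%N ->
  forall r, (r <= j)%N ->
  j%:R + j%:R * \sum_(r.+1 <= i < j.+1) av (f0 (iter n T (iter i S z))) <
    av (f0 (iter n T (iter r S z))).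
have g1 j k : generic (G1 j k).
  move=> v0 e e0; have j0 : 0 < j.+1%:R^-1 / 2 :> R by rewrite divr_gt0// invr_gt0.
  have d0 : 0 < Num.min e (j.+1%:R^-1 / 2) by rewrite lt_min e0.
  have [v [n []]] := orbit_transitive v0 (d k) d0; rewrite !lt_min.
  (* Half of the tolerance is left to perturbation, and $\|T^n\| \le 2^n$ fixes the radius. *)
  move=> /andP[ve _] /andP[_ vd]; exists v, (j.+1%:R^-1 / 2 / 2 ^+ n); split => //.
  move=> z zv; exists n; rewrite (le_lt_trans (nm_sub _ _ (iter n T v)))//.
  have : nm (iter n T z - iter n T v) <= j.+1%:R^-1 / 2.
    by rewrite (le_trans (iter_T_close _ _ _))// mulrC -ler_pdivlMr.
  by move: vd; move: (j.+1%:R^-1 : R) => q; lra.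
have g2 j : generic (G2 j).
  move=> v0 e e0; have j0 : 0 < j.+1%:R^-1 / 2 :> R by rewrite divr_gt0// invr_gt0.
  have d0 : 0 < Num.min e (j.+1%:R^-1 / 2) by rewrite lt_min e0.
  have [v [M []]] := killing_orbit v0 j d0; rewrite lt_min => /andP[ve _] jM vM.
  exists v, (j.+1%:R^-1 / 2 / 2 ^+ M); split => //.
  move=> z zv; exists M => // n Mn nM; have := vM n Mn nM; rewrite lt_min => /andP[_ vn].
  rewrite -[iter n T z](subrK (iter n T v)) (le_lt_trans (nmD _ _))//.
  have : nm (iter n T z - iter n T v) <= j.+1%:R^-1 / 2.
    rewrite (le_trans (iter_T_close _ _ _))// mulrC.
    rewrite (le_trans (ler_wpM2l (nm_ge0 _) (_ : 2 ^+ n <= 2 ^+ M)))//.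
      by rewrite ler_weXn2l// ler1n.
    by rewrite -ler_pdivlMr.
  by move: vn; move: (j.+1%:R^-1 : R) => q; lra.
have c00 : 0 <= c0.
  apply: (functional_ge0 (x := y 0%N) f0_functional); apply/eqP => y0.
  by have := f0_y 0; rewrite y0 (functional0 f0_functional) => /esym/eqP; rewrite oner_eq0.
have g3 j : generic (G3 j).
  move=> v0 e e0; have [v [M [ve jM vM]]] := escaping_orbit v0 j e0.
  (* Within radius $1/C$ each of the quantities compared moves by at most $1/(j^2+1)$. The total
     loss is at most $j \cdot j/(j^2+1) + 1/(j^2+1) = 1$, exactly the gap between $j+1$ in
     [escaping_orbit] and $j$ here. *)
  pose C : R := (c0 + 1) * 2 ^+ M * (j%:R * j%:R + 1).
  have C0 : 0 < C by rewrite !mulr_gt0// ltr_pwDr// mulr_ge0.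
  exists v, C^-1; split => //; first by rewrite invr_gt0.
  move=> z zv; exists M => // n Mn nM r rj.
  have close i : `|av (f0 (iter n T (iter i S z))) - av (f0 (iter n T (iter i S v)))| <=
      (j%:R * j%:R + 1)^-1.
    have h : av (f0 (iter n T (iter i S z)) - f0 (iter n T (iter i S v))) <= (j%:R * j%:R + 1)^-1.
      rewrite -(functionalB f0_functional) (le_trans (f0_functional.2 _))//.
      have -> : iter n T (iter i S z) - iter n T (iter i S v) = iter n T (iter i S (z - v)).
        have E1 := iter_linear S_linear i (-1) v z.
        have E2 := iter_linear T_linear n (-1) (iter i S v) (iter i S z).
        by rewrite !scaleN1r in E1 E2; rewrite [z - v]addrC E1 E2 addrC.
      rewrite -[leRHS]mul1r ler_pdivlMr; last by rewrite ltr_pwDr// mulr_ge0.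
      have : C * nm (z - v) <= 1 by rewrite mulrC -ler_pdivlMr// mul1r.
      apply: le_trans; rewrite /C [leRHS]mulrAC ler_wpM2r ?addr_ge0 ?mulr_ge0//.
      rewrite -mulrA ler_pM ?nm_ge0 ?lerDl// (le_trans (iter_T_bound _ _))//.
      apply: ler_pM; rewrite ?nm_ge0 ?iter_S_bound ?(ltW (Ngt0 _))//.
      by rewrite ler_weXn2l ?ler1n.
    exact: le_trans (av_dist _ _) h.
  have := vM n Mn nM r rj.
  set s := \sum_(_ <= i < _) _; set s' := \sum_(_ <= i < _) _ => vr.
  have jj0 : 0 < j%:R * j%:R + 1 :> R by rewrite ltr_pwDr// mulr_ge0.
  have ss : s' <= s + j%:R * (j%:R * j%:R + 1)^-1.
    apply: (@le_trans _ _ (\sum_(r.+1 <= i < j.+1)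
        (av (f0 (iter n T (iter i S v))) + (j%:R * j%:R + 1)^-1))).
      apply: ler_sum_nat => i _; have := close i.
      by rewrite ler_norml => /andP[_]; rewrite lerBlDl.
    rewrite big_split/= lerD2l sumr_const_nat -[leLHS]mulr_natl ler_wpM2r ?invr_ge0 ?(ltW jj0)//.
    by rewrite ler_nat subSS leq_subr.
  have := close r; rewrite ler_norml => /andP[cr _].
  have jE : j.+1%:R = j%:R + 1 :> R by rewrite natr1.
  have : j%:R * s' <= j%:R * s + j%:R * (j%:R * (j%:R * j%:R + 1)^-1).
    by rewrite -mulrDr ler_wpM2l.
  have : j%:R * (j%:R * (j%:R * j%:R + 1)^-1) + (j%:R * j%:R + 1)^-1 = 1 :> R.
    by rewrite mulrA -[X in _ + X]mul1r -mulrDl mulfV// gt_eqF.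
  by move: cr vr; rewrite jE; move: (_^-1) (j%:R * s) (j%:R * s') => q0 q1 q2; lra.
(* Stage $j$ handles only the targets $k < j$, so a single sequence of conditions covers the doubly
   indexed family. *)
have [z zG] := @baire_generic
  (fun j z => (forall k, (k < j)%N -> G1 j k z) /\ (G2 j z /\ G3 j z))
  (fun j => genericI (generic_forall_lt j (g1 j)) (genericI (g2 j) (g3 j))).
exists z; split.
- move=> k e e0; have [j je] := invS_lt e0.
  have [zG1 _] := zG (maxn j k).+1; have [n zn] := zG1 k (leq_maxr _ _).
  exists n; rewrite (lt_trans zn)// (le_lt_trans _ je)// lef_pV2 ?posrE// ler_nat.
  by rewrite ltnS leqW// leq_maxl.
- by move=> j; have [_ []] := zG j.
- by move=> j; have [_ []] := zG j.
Qed.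
End Dynamics.

Theorem exists_chaotic_operator (d : nat -> X) :
  (forall v (e : R), 0 < e -> exists k, nm (v - d k) < e) ->
  exists (S : X -> X) (f0 : X -> K) (c0 : R) (z : X),
  [/\ (forall a u v, S (a *: u + v) = a *: S u + S v) /\ (forall v, nm (S v) <= nm v),
      functional f0 c0,
      forall v (e : R), 0 < e -> exists n, nm (iter n (fun v => v + S v) z - v) < e,
      forall j : nat, exists2 M, (j < M)%N & forall n, (M <= j.+1 * n)%N -> (n <= M)%N ->
        nm (iter n (fun v => v + S v) z) < j.+1%:R^-1 &
      forall j : nat, exists2 M, (j < M)%N & forall n, (M <= j.+1 * n)%N -> (n <= M)%N ->
        forall r, (r <= j)%N ->
        j%:R + j%:R * \sum_(r.+1 <= i < j.+1)
            av (f0 (iter n (fun v => v + S v) (iter i S z))) <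
          av (f0 (iter n (fun v => v + S v) (iter r S z)))].
Proof.
move=> d_dense; have [x [f [F [xf dx FN]]]] := exists_biorthogonal_sequence d.
have [S [y [f0 [c0 [b [[SL Sb] [Sy0 SyS] [f0f f0y] yd [b0 bN]]]]]]] :=
  exists_shift_operator xf d_dense dx FN.
have [z [z1 z2 z3]] := exists_generic_vector SL Sb Sy0 SyS f0f f0y yd b0 bN d.
exists S, f0, c0, z; split => // v e e0.
have e20 : 0 < e / 2 by rewrite divr_gt0.
have [k dk] := d_dense v _ e20; have [n zn] := z1 k _ e20; exists n.
by rewrite (le_lt_trans (nm_sub _ _ (d k)))// [nm (d k - v)]nm_subC; lra.
Qed.

Lemma separable_dense_sequence : separable X ->
  exists d : nat -> X, forall v (e : R), 0 < e -> exists k, nm (v - d k) < e.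
Proof.
case=> D [/countable_injP[h hinj] Ddense].
have /choice[d dP] : forall k, exists x : X, (exists2 x', D x' & h x' = k) -> D x /\ h x = k.
  move=> k; have [[x Dx hx]|nox] := pselect (exists2 x', D x' & h x' = k).
    by exists x.
  by exists 0 => /nox.
exists d => v e e0.
have ie0 : 0 < iota e by rewrite -(rmorph0 iota) iota_lt.
have [||x [vx Dx]] := Ddense (ball v (iota e)).
- by exists v; exact: ballxx.
- exact: ball_open.
have [Ddk hdk] := dP (h x) (ex_intro2 _ _ x Dx erefl).
exists (h x); have -> : d (h x) = x by apply: hinj; rewrite ?inE.
by move: vx; rewrite -ball_normE /= nmE iota_lt.
Qed.

Lemma dense_approx (A : set X) :
  (forall v (e : R), 0 < e -> exists2 x, A x & nm (x - v) < e) -> dense A.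
Proof.
move=> HA O [v Ov] openO; have /nbhs_ballP[e /= e0 eO] : nbhs v O by exact: open_nbhs_nbhs.
have re0 : 0 < re e by rewrite -iota_lt rmorph0 iota_re// ltW.
have [x Ax xv] := HA v _ re0; exists x; split => //; apply: eO.
by rewrite -ball_normE /= nmE -(iota_re (ltW e0)) iota_lt nm_subC.
Qed.

(** * The irregular manifold and the chaotic set *)

Section Conclusion.
Variables (S : X -> X) (f0 : X -> K) (c0 : R) (z : X).
Hypothesis S_linear : forall a u v, S (a *: u + v) = a *: S u + S v.
Hypothesis S_bound : forall v, nm (S v) <= nm v.
Hypothesis f0_functional : functional f0 c0.
Variable T : {linear X -> X}.
Hypothesis TE : forall v, T v = v + S v.
Hypothesis z_dense : forall v (e : R), 0 < e -> exists n, nm (iter n T z - v) < e.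
Hypothesis z_small : forall j : nat, exists2 M, (j < M)%N &
  forall n, (M <= j.+1 * n)%N -> (n <= M)%N -> nm (iter n T z) < j.+1%:R^-1.
Hypothesis z_large : forall j : nat, exists2 M, (j < M)%N &
  forall n, (M <= j.+1 * n)%N -> (n <= M)%N -> forall r, (r <= j)%N ->
  j%:R + j%:R * \sum_(r.+1 <= i < j.+1) av (f0 (iter n T (iter i S z))) <
    av (f0 (iter n T (iter r S z))).

Definition orbit_span : set X :=
  [set u | exists m (a : nat -> K), u = \sum_(i < m) a i *: iter i S z].

Lemma orbit_span_pad m m' (a : nat -> K) : (m <= m')%N ->
  \sum_(i < m) a i *: iter i S z =
  \sum_(i < m') (if (i < m)%N then a i else 0) *: iter i S z.
Proof.
move=> /subnKC <-; rewrite big_split_ord/= [X in _ + X]big1 ?addr0 => [|i _].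
  by apply: eq_bigr => i _; rewrite ltn_ord.
by rewrite ltnNge leq_addr scale0r.
Qed.

Lemma orbit_span_subspace : linear_subspace orbit_span.
Proof.
split; first by exists 0%N, (fun=> 0); rewrite big_ord0.
move=> c u v [m [a ->]] [m' [a' ->]].
rewrite (orbit_span_pad a (leq_addr m' m)) (orbit_span_pad a' (leq_addl m m')).
exists (m + m')%N, (fun i => c * (if (i < m)%N then a i else 0) +
  (if (i < m')%N then a' i else 0)).
rewrite scaler_sumr -big_split/=; apply: eq_bigr => i _.
by rewrite scalerA scalerDl.
Qed.

(** The span is stable under $S$, hence under $T = I + S$; it contains the orbit of $z$ and inherits
    its density. *)
Lemma orbit_span_iter n : orbit_span (iter n T z).
Proof.
elim: n => [|n [m [a IH]]]; first by exists 1%N, (fun=> 1); rewrite big_ord1 scale1r.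
rewrite iterS TE addrC -[S _]scale1r; apply: (orbit_span_subspace.2); last by exists m, a.
exists m.+1, (fun i => if i is i'.+1 then a i' else 0).
rewrite big_ord_recl scale0r add0r IH (linear_fun_sum S_linear).
by apply: eq_bigr => i _; rewrite (linear_funZ S_linear).
Qed.

Lemma orbit_span_dense : dense orbit_span.
Proof.
apply: dense_approx => v e e0; have [n zn] := z_dense v e0.
by exists (iter n T z) => //; exact: orbit_span_iter.
Qed.

Let iterTD n : forall a u v, iter n T (a *: u + v) = a *: iter n T u + iter n T v.
Proof. by move=> a u v; apply: iter_linear => *; rewrite linearP. Qed.

Let iterTS n i v : iter n T (iter i S v) = iter i S (iter n T v).
Proof.
have TS u : T (S u) = S (T u) by rewrite !TE (linear_funD S_linear).
have TSi i' u : T (iter i' S u) = iter i' S (T u).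
  by elim: i' => [//|i' IH]; rewrite !iterS TS IH.
by elim: n => [//|n IH]; rewrite !iterS IH TSi.
Qed.

(** $T$ commutes with $S$ and $\|S\| \le 1$, so $\|T^n S^i z\| \le \|T^n z\|$: the whole span is
    small along the windows of $z$. *)
Lemma orbit_span_small u : orbit_span u -> exists2 C : R, 0 < C &
  forall j : nat, exists2 M, (j < M)%N &
    forall n, (M <= j.+1 * n)%N -> (n <= M)%N -> nm (iter n T u) <= C / j.+1%:R.
Proof.
move=> [m [a ->]]; exists (1 + \sum_(i < m) av (a i)).
  by rewrite ltr_pwDl// sumr_ge0.
move=> j; have [M jM HM] := z_small j; exists M => // n Mn nM.
rewrite (linear_fun_sum (iterTD n)) (le_trans (nm_sum _ _ _))//.
have zn := HM n Mn nM.
apply: (@le_trans _ _ (\sum_(i < m) av (a i) / j.+1%:R)).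
  apply: ler_sum => i _; rewrite (linear_funZ (iterTD n)) nmZ ler_wpM2l// iterTS.
  rewrite (le_trans _ (ltW zn))//.
  by elim: (i : nat) => [//|i' IH]; rewrite iterS (le_trans (S_bound _)).
by rewrite -mulr_suml ler_wpM2r ?invr_ge0// lerDr.
Qed.

(** Let $r$ be the least index with $a_r \ne 0$. For large $j'$ the domination gives $|f_0(T^n u)|
    \ge |a_r|\, j'$, and $f_0$ is bounded. *)
Lemma orbit_span_large u : orbit_span u -> u != 0 -> exists2 C : R, 0 < C &
  forall j : nat, exists2 M, (j < M)%N &
    forall n, (M <= j.+1 * n)%N -> (n <= M)%N -> j%:R <= C * nm (iter n T u).
Proof.
move=> [m [a uE]] u0.
have ex_r : exists r, (r < m)%N && (a r != 0).
  apply: contrapT => nor; move/eqP: u0; apply; rewrite uE big1// => i _.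
  have [->|ai] := eqVneq (a i) 0; first by rewrite scale0r.
  by case: nor; exists i; rewrite ltn_ord.
case: (ex_minnP ex_r) => r /andP[rm ar] rmin {ex_r}.
have av_ar : 0 < av (a r) by rewrite lt_neqAle eq_sym av_eq0 ar av_ge0.
have c00 : 0 <= c0 by exact: functional_ge0 f0_functional u0.
have c1 : 0 < c0 + 1 by rewrite ltr_pwDr.
(* [c0] is only known to be nonnegative; adding 1 makes the constant positive. *)
exists ((c0 + 1) / av (a r)); first by rewrite divr_gt0.
move=> j.
(* $J$ bounds both the number of coefficients, so that the dominated sum contains all of them, and
   every ratio $|a_i|/|a_r|$. *)
pose J := (m + \sum_(i < m) (Num.truncn (av (a i) / av (a r))).+1)%N.
have [M jM HM] := z_large (maxn j J).
exists M; first by rewrite (leq_ltn_trans _ jM)// leq_maxl.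
move=> n Mn nM; set j' := maxn j J in jM HM.
have jj' : (j <= j')%N by exact: leq_maxl.
have Jj' : (J <= j')%N by exact: leq_maxr.
have mj' : (m <= j')%N by rewrite (leq_trans _ Jj')// leq_addr.
have Mn' : (M <= j'.+1 * n)%N by rewrite (leq_trans Mn)// leq_mul2r ltnS jj' orbT.
have := HM n Mn' nM r (leq_trans (ltnW rm) mj').
set s := \sum_(_ <= i < _) _ => large.
pose F v := f0 (iter n T v).
have F_lin b v w : F (b *: v + w) = b * F v + F w by rewrite /F iterTD f0_functional.1.
have FE : F u = a r * F (iter r S z) + \sum_(r.+1 <= i < m) a i * F (iter i S z).
  have F0 : F 0 = 0.
    by rewrite /F (linear_fun0 (iterTD n)) (functional0 f0_functional).
  have FS : forall v w, F (v + w) = F v + F w.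
    by move=> v w; have := F_lin 1 v w; rewrite scale1r mul1r.
  have FZ b v : F (b *: v) = b * F v by have := F_lin b v 0; rewrite F0 !addr0.
  rewrite uE (big_morph F FS F0) -(big_mkord xpredT (fun i => F (a i *: iter i S z))).
  rewrite (big_cat_nat (n := r)) ?(ltnW rm)//= big_nat big1 ?add0r => [|i /andP[_ ir]].
    rewrite big_ltn// FZ; congr (_ + _); apply: eq_bigr => i _; exact: FZ.
  have [->|ai] := eqVneq (a i) 0; first by rewrite scale0r F0.
  by move: (rmin i); rewrite (ltn_trans ir rm) ai leqNgt ir => /(_ isT).
have ratio i : (i < m)%N -> av (a i) <= j'%:R * av (a r).
  move=> im; rewrite -ler_pdivrMr// (le_trans (ltW (truncnS_gt _)))// ler_nat.
  rewrite (leq_trans _ Jj')// /J (bigD1 (Ordinal im))//= addnCA leq_addr//.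
have tail : av (\sum_(r.+1 <= i < m) a i * F (iter i S z)) <= j'%:R * av (a r) * s.
  rewrite (le_trans (av_sum _ _ _))// /s mulr_sumr.
  rewrite [leRHS](big_cat_nat (n := m))//=; last exact: leqW.
  rewrite -[leLHS]addr0 lerD//.
    apply: ler_sum_nat => i /andP[_ im]; rewrite avM ler_wpM2r//; exact: ratio.
  by apply: sumr_ge0 => i _; rewrite !mulr_ge0.
have lower : av (a r) * j'%:R <= av (F u).
  have h : av (a r * F (iter r S z)) <= av (F u) +
      av (\sum_(r.+1 <= i < m) a i * F (iter i S z)).
    have -> : a r * F (iter r S z) = F u - \sum_(r.+1 <= i < m) a i * F (iter i S z).
      by rewrite FE addrK.
    by rewrite (le_trans (avD _ _))// avN.
  have h' : av (a r) * (j'%:R + j'%:R * s) <= av (a r) * av (F (iter r S z)).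
    by rewrite ler_wpM2l// ltW.
  by move: h h' tail; rewrite avM; lra.
have upper : av (F u) <= (c0 + 1) * nm (iter n T u).
  by rewrite (le_trans (f0_functional.2 _))// ler_wpM2r ?nm_ge0// lerDl.
have jR : j%:R <= j'%:R :> R by rewrite ler_nat.
rewrite mulrAC ler_pdivlMr//.
have : j%:R * av (a r) <= j'%:R * av (a r) by rewrite ler_wpM2r.
by lra.
Qed.

Lemma orbit_span_irregular u : orbit_span u -> u <> 0 ->
  distributionally_irregular R T u.
Proof.
move=> uS /eqP u0.
have [C C0 HC] := orbit_span_small uS; have [D D0 HD] := orbit_span_large uS u0.
have [|n_ [n_inc n_dens n_small]] :=
    @density_one_sequence R (fun j n => nm (iter n T u) <= C / j.+1%:R) _ HC.
  move=> j n /le_trans; apply; rewrite ler_pM2l// lef_pV2 ?posrE// ler_nat//.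
have [|m_ [m_inc m_dens m_large]] :=
    @density_one_sequence R (fun j n => j%:R <= D * nm (iter n T u)) _ HD.
  by move=> j n; apply: le_trans; rewrite ler_nat.
exists n_, m_; split => //.
- apply/cvgrPdist_lt => e e0.
  have re0 : 0 < re e by rewrite -iota_lt rmorph0 iota_re// ltW.
  have [j je] := invS_lt (divr_gt0 re0 C0).
  have [k0 k0P] := n_small j; exists k0 => // k /= k0k.
  rewrite sub0r normrN normr_id nmE -(iota_re (ltW e0)) iota_lt.
  by rewrite (le_lt_trans (k0P k k0k))// mulrC -ltr_pdivlMr.
- move=> A [M [Mreal MA]].
  pose j := (Num.truncn (D * av M)).+1.
  have [k0 k0P] := m_large j; exists k0 => // k /= k0k; apply: MA.
  rewrite (le_lt_trans (real_ler_norm Mreal))// avE nmE iota_lt.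
  rewrite -(ltr_pM2l D0) (lt_le_trans (truncnS_gt _))//; exact: k0P.
Qed.

Lemma uncountable_real : ~ countable [set: R].
Proof.
move=> cR; have := countable_lebesgue_measure0 (sub_countable (subset_card_le (@subsetT _ [set` `[0 : R, 1]])) cR).
by rewrite lebesgue_measure_itv/= lte_fin ltr01 oppr0 adde0 => /eqP; rewrite eqe oner_eq0.
Qed.

Lemma multiples_chaotic : z != 0 -> distributionally_chaotic R T.
Proof.
move=> z0; exists [set iota r *: z | r in [set: R]], 1; split => //.
  move=> cG; apply: uncountable_real.
  have /countable_injP[h hinj] := cG; apply/countable_injP.
  exists (fun r => h (iota r *: z)) => r s _ _ /hinj.
  rewrite !inE => /(_ (ex_intro2 _ _ r I erefl) (ex_intro2 _ _ s I erefl)).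
  move=> /eqP; rewrite -subr_eq0 -scalerBl scaler_eq0 (negbTE z0) orbF subr_eq0.
  by move=> /eqP/iota_inj.
move=> x y [r _ <-] [s _ <-] rs tau tau0.
(* The difference of two multiples of $z$ is a nonzero vector of the span, so the two estimates for
   the manifold yield both densities. *)
pose w := iota r *: z - iota s *: z.
have wS : orbit_span w.
  exists 1%N, (fun=> iota r - iota s); by rewrite big_ord1 scalerBl.
have w0 : w != 0 by rewrite subr_eq0; apply/eqP.
have wE n : iter n T (iota r *: z) - iter n T (iota s *: z) = iter n T w.
  by rewrite /w (linear_funB (iterTD n)).
have [C C0 HC] := orbit_span_small wS; have [D D0 HD] := orbit_span_large wS w0.
split.
- apply: lower_density_eq0 => j.
  (* With an index above $D$ the lower bound gives $D\|T^n w\| > D$, which excludes $\|T^n w\| < 1$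
     on the window. *)
  have [M jM HM] := HD (maxn j (Num.truncn D).+1).
  exists M; first by rewrite (leq_ltn_trans _ jM)// leq_maxl.
  move=> n Mn nM /=; rewrite wE nmE -(rmorph1 iota) iota_lt => n1.
  have h := HM n (leq_trans Mn (leq_mul (_ : j.+1 <= (maxn j (Num.truncn D).+1).+1)%N (leqnn n))) nM.
  have {}h := h (leq_maxl _ _ : (j.+1 <= _.+1)%N).
  have : D < D.
    rewrite (lt_le_trans (truncnS_gt D))//.
    rewrite (le_trans (_ : _ <= (maxn j (Num.truncn D).+1)%:R))// ?ler_nat ?leq_maxr//.
    by rewrite (le_trans h)// ler_piMr ?ltW.
  by rewrite ltxx.
- apply: upper_density_eq1 => j.
  have re0 : 0 < re tau by rewrite -iota_lt rmorph0 iota_re// ltW.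
  pose J := Num.truncn (C / re tau).
  have [M jM HM] := HC (maxn j J).
  exists M; first by rewrite (leq_ltn_trans _ jM)// leq_maxl.
  move=> n Mn nM /=; rewrite wE nmE -(iota_re (ltW tau0)) iota_lt.
  have jJ : (j.+1 <= (maxn j J).+1)%N by rewrite ltnS leq_maxl.
  rewrite (le_lt_trans (HM n (leq_trans Mn (leq_mul jJ (leqnn n))) nM))//.
  rewrite ltr_pdivrMr// mulrC -ltr_pdivrMr// (lt_le_trans (truncnS_gt _))//.
  by rewrite ler_nat ltnS leq_maxr.
Qed.
End Conclusion.

Theorem exists_distributionally_chaotic : separable X -> exists T : {linear X -> X},
  [/\ bounded_near T (nbhs (0 : X)), hypercyclic T, distributionally_chaotic R T &
    exists Y : set X, dense Y /\ distributionally_irregular_manifold R T Y].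
Proof.
move=> /separable_dense_sequence[d d_dense].
have [S [f0 [c0 [z [[SL Sb] f0f zd zs zl]]]]] := exists_chaotic_operator d_dense.
have T_lin : linear (fun v => v + S v) by move=> a u v; rewrite SL scalerDr addrACA.
pose T : {linear X -> X} := HB.pack (fun v => v + S v) (GRing.isLinear.Build K X X *:%R _ T_lin).
have z0 : z != 0.
  (* The empty span is $\{0\}$, so a nonzero $v$ exists; the orbit of 0 would stay at distance
     $\|v\|$ from it. *)
  apply/eqP => z0; have [v vS] := not_in_span 0 (fun=> 0).
  have v0 : v != 0 by apply/eqP => v0; apply: vS; exists (fun=> 0); rewrite big_ord0.
  have nv : 0 < nm v by rewrite lt_neqAle eq_sym nm_eq0 v0 nm_ge0.
  have [n] := zd v _ nv; rewrite z0.
  have -> : iter n (fun v => v + S v) 0 = 0.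
    by elim: n => [//|n IH]; rewrite iterS IH add0r (linear_fun0 SL).
  by rewrite sub0r nmN ltxx.
exists T; split.
- exists 2; split => [|M M2]; first exact: realn.
  apply/nbhs_ballP; exists 1 => //= v; rewrite -ball_normE /= sub0r normrN => v1.
  rewrite (le_trans (ler_normD _ _))// (le_trans _ (ltW M2))// -[2]/(1 + 1)%R.
  rewrite lerD ?(ltW v1)// (le_trans _ (ltW v1))// !nmE iota_le; exact: Sb.
- exists z; apply: dense_approx => v e e0; have [n zn] := zd v e e0.
  by exists (iter n T z) => //; exists n.
- exact: (multiples_chaotic SL Sb f0f (T := T)).
- exists (orbit_span S z); split; first exact: (orbit_span_dense SL (T := T)).
  split; first exact: orbit_span_subspace.
  by move=> y yS y0; apply: (orbit_span_irregular SL Sb f0f (T := T) _ zs zl yS y0).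
Qed.
End Core.

(** * Separating functionals over the real and the complex field *)

Lemma real_functional (R : realType) (K : numFieldType) (iota : {rmorphism R -> K})
    (re : K -> R) (X : completeNormedModType K)
    (iota_re : forall k : K, 0 <= k -> iota (re k) = k)
    (iota_le : forall a b : R, (iota a <= iota b) = (a <= b)) (x : X) :
  exists p : X -> R, [/\ forall u v, p (u + v) = p u + p v,
    forall r u, p (iota r *: u) = r * p u,
    forall u, `|p u| <= nm re u & p x = nm re x].
Proof.
have [|p [pD pZ pn px]] := @real_hahn_banach R K iota X (@nm R K re X) x.
  split; first exact: nm0 iota_re iota_le _.
    exact: (nmD iota_re iota_le).
  by move=> r u r0; rewrite (nmZ iota_re iota_le) (av_iota iota_re iota_le) gtr0_norm.
exists p; split => // u; rewrite ler_norml pn andbT.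
have := pn (- u); rewrite nmN lerNl; apply: le_trans.
by have := pZ (-1) u; rewrite rmorphN rmorph1 scaleN1r mulN1r => ->.
Qed.

Section RealCase.
Variables (R : realType) (X : completeNormedModType R).

Lemma real_dual_separates (x : X) : x != 0 ->
  exists g c, @functional R R id X g c /\ g x = 1.
Proof.
move=> x0; have ile (a b : R) : ((idfun : {rmorphism R -> R}) a <= idfun b) = (a <= b) by [].
have ire (k : R) : 0 <= k -> (idfun : {rmorphism R -> R}) (id k) = k by [].
have [p [pD pZ pn px]] := real_functional ire ile x.
have nx : 0 < nm id x by rewrite /nm normr_gt0.
exists (fun u => p u / nm id x), (nm id x)^-1; split; last by rewrite px divff ?gt_eqF.
split=> [a u v|u]; first by rewrite pD (pZ a u) mulrDl mulrA.
by rewrite /av normrM normfV (gtr0_norm nx) mulrC ler_pM2l ?invr_gt0// pn.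
Qed.
End RealCase.

Section ComplexCase.
Variables (R : realType) (X : completeNormedModType R[i]).
Let iota : {rmorphism R -> R[i]} := real_complex R.
Let re : R[i] -> R := @complex.Re R.

Let iota_re (k : R[i]) : 0 <= k -> iota (re k) = k.
Proof. by move=> k0; apply: RRe_real; exact: ger0_real. Qed.

Let iota_le (a b : R) : (iota a <= iota b) = (a <= b).
Proof. exact: lecR. Qed.

(** A real-linear $p$ with $|p| \le \|\cdot\|$ is complexified to $g(u) = p(u) - i\,p(iu)$. Its real
    part at $x$ is $p(x) = \|x\| \ne 0$, so one may divide by $g(x)$; the crude bound $2\|u\|$
    suffices. *)
Lemma complex_dual_separates (x : X) : x != 0 ->
  exists g c, @functional R R[i] re X g c /\ g x = 1.
Proof.
move=> x0; have [p [pD pZ pn px]] := real_functional iota_re iota_le x.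
pose i : R[i] := Complex 0 1.
have ii : i * i = -1 by rewrite -expr2 sqr_i.
have pN u : p (- u) = - p u.
  by have := pZ (-1) u; rewrite rmorphN rmorph1 scaleN1r mulN1r.
pose g u := iota (p u) - i * iota (p (i *: u)).
have gD u v : g (u + v) = g u + g v.
  by rewrite /g scalerDr !pD !rmorphD; ring.
have gR r u : g (iota r *: u) = iota r * g u.
  have comm : i *: (iota r *: u) = iota r *: (i *: u) by rewrite !scalerA mulrC.
  by rewrite /g comm !pZ !rmorphM/= mulrBr [i * (_ * _)]mulrCA.
have gi u : g (i *: u) = i * g u.
  rewrite /g scalerA ii scaleN1r pN rmorphN mulrBr mulrA ii; ring.
have gZ a u : g (a *: u) = a * g u.
  rewrite [a]complexE scalerDl gD -scalerA -[Complex 0 1]/i.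
  by rewrite gi -/(iota _) gR -/(iota _) gR mulrDl mulrA.
have avi : av re i = 1.
  have := avM iota_re iota_le i i.
  rewrite ii (avN re) (av1 iota_re iota_le) -expr2 => /esym/eqP.
  by rewrite sqrf_eq1 => /orP[/eqP//|/eqP avN1]; have := av_ge0 iota_re iota_le i;
    rewrite avN1 oppr_ge0 ler10.
have gb u : av re (g u) <= 2 * nm re u.
  rewrite /g (le_trans (avD iota_re iota_le _ _))// (avN re) (avM iota_re iota_le) avi mul1r.
  rewrite !(av_iota iota_re iota_le) mulr_natl mulr2n lerD//.
  by have := pn (i *: u); rewrite (nmZ iota_re iota_le) avi mul1r.
have gx0 : g x != 0.
  apply/eqP => /(congr1 (@complex.Re R)).
  rewrite /g /= mul0r mulr0 subr0 oppr0 addr0 px => /eqP.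
  by rewrite (nm_eq0 iota_re iota_le) (negbTE x0).
exists (fun u => g u / g x), (2 / av re (g x)); split; last by rewrite divff.
split=> [a u v|u]; first by rewrite gD gZ mulrDl mulrA.
rewrite (avM iota_re iota_le) (avV iota_re iota_le) mulrAC ler_wpM2r// invr_ge0.
exact: av_ge0 iota_re iota_le _.
Qed.
End ComplexCase.

Theorem theorem35 (R : realType) :
  (forall X : completeNormedModType R,
     ~ finite_dimensional X -> separable X ->
     exists T : {linear X -> X},
       [/\ bounded_near T (nbhs (0 : X)),
           hypercyclic T,
           distributionally_chaotic R T
         & exists Y : set X,
             dense Y /\ distributionally_irregular_manifold R T Y]) /\
  (forall X : completeNormedModType R[i],
     ~ finite_dimensional X -> separable X ->
     exists T : {linear X -> X},
       [/\ bounded_near T (nbhs (0 : X)),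
           hypercyclic T,
           distributionally_chaotic R T
         & exists Y : set X,
             dense Y /\ distributionally_irregular_manifold R T Y]).
Proof.
split=> X Xinf Xsep.
- apply: (@exists_distributionally_chaotic R R idfun id) => //.
  exact: real_dual_separates.
- apply: (@exists_distributionally_chaotic R R[i] (real_complex R) (@complex.Re R)) => //.
  + by move=> k k0; apply: RRe_real; exact: ger0_real.
  + exact: lecR.
  + exact: complex_dual_separates.
Qed.
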